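(* One has that $$\imath^{\mathrm{spr}}\circ\dot\partial_{\mathrm{spr}}=\mathrm{Id}_{\mathscr{C}_{\mathrm{spr}}(A)},\qquad\imath^{\mathrm{nl}}\circ\dot\partial_{\mathrm{nl}}=\mathrm{Id}_{\mathscr{C}_{\mathrm{nl}}(A)},\qquad\imath_{\mathbb{C}}\circ\dot\partial_{\mathrm{anis}}=0\colon\mathscr{C}_{\mathrm{anis}}(A)\to\mathrm{h}_0\mathcal{T}^1_2(M_A).$$ As consequences, $\dot\partial_{\mathrm{spr}}$ and $\dot\partial_{\mathrm{nl}}$ are injective, $\imath^{\mathrm{spr}}$ and $\imath^{\mathrm{nl}}$ are surjective, and the following decompositions hold: (i) $\mathscr{C}_{\mathrm{nl}}(A)=\mathrm{Img}(\dot\partial_{\mathrm{spr}})\oplus\mathrm{Ker}\big(\imath_{\mathbb{C}}\colon\mathrm{h}_1\mathcal{T}^1_1(M_A)\to\mathrm{h}_2\mathcal{T}^1_0(M_A)\big)$, where each $N\in\mathscr{C}_{\mathrm{nl}}(A)$ decomposes as $$N=\dot\partial_{\mathrm{spr}}(\imath^{\mathrm{spr}}N)+\{N-\dot\partial_{\mathrm{spr}}(\imath^{\mathrm{spr}}N)\}.$$ (ii) $\mathscr{C}_{\mathrm{anis}}(A)=\mathrm{Img}(\dot\partial_{\mathrm{nl}})\oplus\mathrm{Ker}\big(\imath_{\mathbb{C}}\colon\mathrm{h}_0\mathcal{T}^1_2(M_A)\to\mathrm{h}_1\mathcal{T}^1_1(M_A)\big)$, where each $\Gamma\in\mathscr{C}_{\mathrm{anis}}(A)$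 decomposes as $$\Gamma=\dot\partial_{\mathrm{nl}}(\imath^{\mathrm{nl}}\Gamma)+\{\Gamma-\dot\partial_{\mathrm{nl}}(\imath^{\mathrm{nl}}\Gamma)\}.$$
   Context: $M$ is a smooth (Hausdorff, second countable) $n$-dimensional manifold and $A\subseteq \mathrm{T}M\setminus\mathbf{0}$ is open with every fiber $A_p:=A\cap \mathrm{T}_pM$ ($p\in M$) nonempty and conic (closed under multiplication by $\lambda\in\mathbb{R}^+=(0,\infty)$). $\pi_A\colon A\to M$ is the natural projection and $h_\lambda\colon A\to A$, $h_\lambda(v)=\lambda v$. All objects are smooth ($\mathcal{C}^\infty$). Anisotropic tensors: $\mathcal{T}^r_s(M_A)$ is the set of sections of $\pi_A^*(\mathrm{T}M^{\otimes r}\otimes\mathrm{T}^*M^{\otimes s})\to A$; $\mathrm{h}_\alpha\mathcal{T}^r_s(M_A)$ those whose components in natural coordinates $(x^i,y^i)$ of $\mathrm{T}M$ satisfy $T(x,\lambda y)=\lambda^\alpha T(x,y)$ for $\lambda\in\mathbb{R}^+$. The Liouville field is $\mathbb{C}=y^i\partial_{x^i}$, and $(\imath_{\mathbb{C}}S)^I_{j_1\ldots j_s}=S^I_{j_1\ldots j_sa}y^a$ (contraction on the last index). In the third identity, $\imath_{\mathbb{C}}$ is $\mathrm{h}_{-1}\mathcal{T}^1_3(M_A)\to\mathrm{h}_0\mathcal{T}^1_2(M_A)$. We write $f_{\cdot k}=\partial f/\partial y^k$. Let $\mathrm{V}A\subset\mathrm{T}A$ be the vertical bundle, identified with $\pi_A^*(\mathrm{T}M)$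 ($\partial_{y^i}\equiv\partial_{x^i}$). $\mathscr{C}_{\mathrm{spr}}(A)$: sprays, i.e. vector fields $G$ on $A$ with $\mathrm{d}(\pi_A)_v(G_v)=v$ and $G_{\lambda v}=\lambda\,\mathrm{d}(h_\lambda)_v(G_v)$; locally $G=y^i\partial_{x^i}-2G^i\partial_{y^i}$ with $G^i$ $2$-homogeneous. $\mathscr{C}_{\mathrm{nl}}(A)$: ($1$-homogeneous) nonlinear connections, i.e. assignments $v\in A\mapsto N_v\in\mathrm{Hom}(\mathrm{T}_{\pi(v)}M,\mathrm{T}_vA)$ with $\mathrm{d}(\pi_A)_v\circ N_v=\mathrm{Id}$ and $N_{\lambda v}=\mathrm{d}(h_\lambda)_v\circ N_v$; locally $N=(\delta^i_j\partial_{x^i}-N^i_j\partial_{y^i})\otimes\mathrm{d}x^j$ with $N^i_j$ $1$-homogeneous. It is an affine space directed by $\mathrm{h}_1\mathcal{T}^1_1(M_A)$. $\mathscr{C}_{\mathrm{anis}}(A)$: ($0$-homogeneous) anisotropic connections, i.e. sections of $\pi_A^*(\mathrm{C}M)\to A$ invariant under $v\mapsto\lambda v$, where $\mathrm{C}M\to M$ is the bundle whose sections are the affine connections on $M$; locally given by $0$-homogeneous functions $\Gamma^i_{jk}$ on $A\cap\mathrm{T}U$ transforming as classical Christoffel symbols. It is an affine space directed by $\mathrm{h}_0\mathcal{T}^1_2(M_A)$. The following maps are well defined by their (chart-independent) coordinate expressions: $\dot\partial_{\mathrm{spr}}\colon\mathscr{C}_{\mathrm{spr}}(A)\to\mathscr{C}_{\mathrm{nl}}(A)$,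 $\dot\partial_{\mathrm{spr}}G=(\delta^i_j\partial_{x^i}-G^i_{\cdot j}\partial_{y^i})\otimes\mathrm{d}x^j$; $\imath^{\mathrm{spr}}\colon\mathscr{C}_{\mathrm{nl}}(A)\to\mathscr{C}_{\mathrm{spr}}(A)$, $\imath^{\mathrm{spr}}N=y^i\partial_{x^i}-N^i_ay^a\partial_{y^i}$; $\dot\partial_{\mathrm{nl}}\colon\mathscr{C}_{\mathrm{nl}}(A)\to\mathscr{C}_{\mathrm{anis}}(A)$, $\dot\partial_{\mathrm{nl}}N\equiv\{N^i_{j\,\cdot k}\}$; $\imath^{\mathrm{nl}}\colon\mathscr{C}_{\mathrm{anis}}(A)\to\mathscr{C}_{\mathrm{nl}}(A)$, $\imath^{\mathrm{nl}}\Gamma=(\delta^i_j\partial_{x^i}-\Gamma^i_{ja}y^a\partial_{y^i})\otimes\mathrm{d}x^j$; $\dot\partial_{\mathrm{anis}}\colon\mathscr{C}_{\mathrm{anis}}(A)\to\mathrm{h}_{-1}\mathcal{T}^1_3(M_A)$, $\dot\partial_{\mathrm{anis}}\Gamma=\Gamma^i_{jk\,\cdot l}\,\partial_{x^i}\otimes\mathrm{d}x^j\otimes\mathrm{d}x^k\otimes\mathrm{d}x^l$. The symbol $\oplus$ between a subset of an affine space and a subspace of its directing vector space means unique expressibility: in (i), each $N\in\mathscr{C}_{\mathrm{nl}}(A)$ can be uniquely written as $N=\dot\partial_{\mathrm{spr}}G-J$ with $G\in\mathscr{C}_{\mathrm{spr}}(A)$ and $J\in\mathrm{Ker}(\imath_{\mathbb{C}})$,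 where $N-J:=\{\delta^i_j\partial_{x^i}-(N^i_j+J^i_j)\partial_{y^i}\}\otimes\mathrm{d}x^j$ (so differences of nonlinear connections are identified with elements of $\mathrm{h}_1\mathcal{T}^1_1(M_A)$ via $\partial_{y^i}\equiv\partial_{x^i}$); in (ii), each $\Gamma$ can be uniquely written as $\dot\partial_{\mathrm{nl}}N+P$ with $N\in\mathscr{C}_{\mathrm{nl}}(A)$ and $P\in\mathrm{Ker}(\imath_{\mathbb{C}})$, with $\Gamma+P\equiv\{\Gamma^i_{jk}+P^i_{jk}\}$. *)

(* Defs.v *)
From HB Require Import structures.
From mathcomp Require Import all_boot all_order all_algebra.
From mathcomp Require Import all_classical all_reals all_analysis.

Set Implicit Arguments.
Unset Strict Implicit.
Unset Printing Implicit Defensive.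
Import Order.TTheory GRing.Theory Num.Theory.
Import numFieldNormedType.Exports.
Local Open Scope classical_set_scope.
Local Open Scope ring_scope.

(* [Ck k U f]: f is of class C^k on the open set U. For finite dimensional E
   (the only use below), continuity of the k-th differential amounts to
   continuity of its values on each tuple of vectors. *)
Fixpoint Ck {R : realType} {E F : normedModType R} (k : nat) (U : set E)
    (f : E -> F) : Prop :=
  if k is k'.+1 then
    (forall x, U x -> differentiable f x) /\
    (forall v : E, Ck k' U (fun x => 'd f x v))
  else forall x, U x -> {for x, continuous f}.

Definition smooth_on {R : realType} {E F : normedModType R} (U : set E)
    (f : E -> F) : Prop :=
  forall k, Ck k U f.

(* [cmap] and [cinv] are total; only their restrictions to [cdom] and to
   [cmap @` cdom] are meaningful. *)
Record chart {R : realType} (E : normedModType R) (X : Type) := Chart {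
  cdom : set X;
  cmap : X -> E;
  cinv : E -> X }.

(* An atlas with a preferred chart around each point. The tangent space at x
   is E itself, a vector being identified with its components in the preferred
   chart at x; hence the tangent bundle of X is the type X * E. *)
Record atlas {R : realType} (E : normedModType R) (X : Type) := Atlas {
  aidx : Type;
  achart :> aidx -> chart E X;
  apref : X -> aidx }.

Section Charts.
Context {R : realType} {E : normedModType R} {X : Type} (a : atlas E X).
Implicit Types (i j : aidx a) (x : X).

Definition transition i j : E -> E := cmap (a j) \o cinv (a i).

(* Components in the chart i of the tangent vector v at x. *)
Definition tcoord i x (v : E) : E :=
  'd (transition (apref a x) i) (cmap (a (apref a x)) x) v.

(* The tangent vector at x with components w in the chart i. *)
Definition tvec i x (w : E) : E :=
  'd (transition i (apref a x)) (cmap (a i) x) w.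

(* Second differential, at x and on tangent vectors at x, of the transition
   from the preferred chart at x to the chart i. *)
Definition transition2 i x (u1 u2 : E) : E :=
  'd (fun z => 'd (transition (apref a x) i) z u1)
     (cmap (a (apref a x)) x) u2.

Definition atlas_open (S : set X) : Prop :=
  forall i, open (cmap (a i) @` (S `&` cdom (a i))).

(* Natural charts (x, y) of the tangent bundle. *)
Definition tangent_atlas : atlas (E * E)%type (X * E)%type :=
  {| aidx := aidx a;
     achart := fun i =>
       {| cdom := [set v | cdom (a i) v.1];
          cmap := fun v => (cmap (a i) v.1, tcoord i v.1 v.2);
          cinv := fun z => let x := cinv (a i) z.1 in (x, tvec i x z.2) |};
     apref := fun v => apref a v.1 |}.

End Charts.

Definition mdiff {R : realType} {E F : normedModType R} {X Y : Type}
    (a : atlas E X) (b : atlas F Y) (f : X -> Y) (x : X) : E -> F :=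
  'd (cmap (b (apref b (f x))) \o f \o cinv (a (apref a x)))
     (cmap (a (apref a x)) x).

Record smoothManifold {R : realType} (E : normedModType R) := SmoothManifold {
  mcarrier :> topologicalType;
  matlas : atlas E mcarrier;
  mhausdorff : hausdorff_space mcarrier;
  msecond_countable : @second_countable mcarrier;
  mcdom_open : forall i, open (cdom (matlas i));
  mcodom_open : forall i, open (cmap (matlas i) @` cdom (matlas i));
  mcmapK : forall i x, cdom (matlas i) x -> cinv (matlas i) (cmap (matlas i) x) = x;
  mcmap_continuous : forall i x, cdom (matlas i) x ->
    {for x, continuous (cmap (matlas i))};
  mcinv_continuous : forall i z, (cmap (matlas i) @` cdom (matlas i)) z ->
    {for z, continuous (cinv (matlas i))};
  mpref : forall x, cdom (matlas (apref matlas x)) x;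
  msmooth : forall i j,
    smooth_on (cmap (matlas i) @` (cdom (matlas i) `&` cdom (matlas j)))
              (transition (a := matlas) i j) }.

Section Anisotropic.
Context {R : realType} {n : nat} {M : smoothManifold 'rV[R]_n}.
Local Notation E := 'rV[R]_n.
Local Notation TM := (M * E)%type.
Local Notation xM := (matlas M).
Local Notation xTM := (tangent_atlas (matlas M)).
Implicit Types (A : set TM) (v : TM) (i : aidx xM) (z : E * E) (lambda : R).

Definition hmul lambda v : TM := (v.1, lambda *: v.2).

Definition conic_domain A : Prop :=
  [/\ atlas_open xTM A,
      (forall v, A v -> v.2 != 0),
      (forall p : M, exists y : E, A (p, y)) &
      (forall lambda v, 0 < lambda -> A v -> A (hmul lambda v))].

(* The natural coordinate domain of A over the chart i. *)
Definition coord_dom A i : set (E * E) :=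
  cmap (xTM i) @` (A `&` cdom (xTM i)).

(* A section over A of a bundle is encoded as a function on TM taking, at v,
   a value in the fiber over v, and vanishing off A; thus equality of sections
   is Leibniz equality. The following types are those of such functions for the
   bundles T(TM), Hom(pi^*TM, T(TM)), pi^*CM and pi^*(TM (x) T^*M^(x)s). As for
   tangent vectors, values at v are read in the preferred chart at v.1. *)
Definition vfield : Type := TM -> E * E.
Definition nlfield : Type := TM -> E -> E * E.
Definition anisfield : Type := TM -> E -> E -> E.
Definition tensfield (s : nat) : Type := TM -> ('I_s -> E) -> E.

Definition vfield_comp i (G : vfield) z : E * E :=
  let v := cinv (xTM i) z in @tcoord _ _ _ xTM i v (G v).

(* G = y^i d/dx^i - 2 G^i d/dy^i *)
Definition spray_coef i (G : vfield) z : E :=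
  - (2^-1 *: (vfield_comp i G z).2).

Definition nl_comp i (N : nlfield) z (u : E) : E * E :=
  let v := cinv (xTM i) z in
  @tcoord _ _ _ xTM i v (N v (tvec (a := xM) i v.1 u)).

(* [nl_coef i N z u] has components N^i_j u^j. *)
Definition nl_coef i (N : nlfield) z (u : E) : E := - (nl_comp i N z u).2.

(* [christoffel i Gam z u1 u2] has components Gamma^i_jk u1^j u2^k in the
   chart i; they are obtained from those in the preferred chart by the
   transformation rule of Christoffel symbols under x' = tau(x):
   Gamma'(Dtau u1, Dtau u2) = Dtau (Gamma(u1, u2)) - D^2tau(u1, u2). *)
Definition christoffel i (Gam : anisfield) z (u1 u2 : E) : E :=
  let v := cinv (xTM i) z in
  let t1 := tvec (a := xM) i v.1 u1 in
  let t2 := tvec (a := xM) i v.1 u2 in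
  tcoord (a := xM) i v.1 (Gam v t1 t2) - transition2 (a := xM) i v.1 t1 t2.

(* [tens_comp i T z w] has components T^i_j1..js w1^j1 .. ws^js. *)
Definition tens_comp (s : nat) i (T : tensfield s) z (w : 'I_s -> E) : E :=
  let v := cinv (xTM i) z in
  tcoord (a := xM) i v.1 (T v (fun k => tvec (a := xM) i v.1 (w k))).

Definition multilinear (s : nat) (f : ('I_s -> E) -> E) : Prop :=
  forall (k : 'I_s) (w : 'I_s -> E), linear (fun u : E => f (dfwith w k u)).

Definition spray A : set vfield := [set G |
  [/\ (forall v, ~ A v -> G v = 0),
      (forall i, smooth_on (coord_dom A i) (vfield_comp i G)),
      (forall v, A v -> mdiff xTM xM fst v (G v) = v.2) &
      (forall v lambda, A v -> 0 < lambda ->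
         G (hmul lambda v) = lambda *: mdiff xTM xTM (hmul lambda) v (G v))]].

Definition nlconn A : set nlfield := [set N |
  [/\ (forall v, ~ A v -> N v = fun=> 0),
      (forall v, A v -> linear (N v)),
      (forall i u, smooth_on (coord_dom A i) (fun z => nl_comp i N z u)),
      (forall v u, A v -> mdiff xTM xM fst v (N v u) = u) &
      (forall v lambda u, A v -> 0 < lambda ->
         N (hmul lambda v) u = mdiff xTM xTM (hmul lambda) v (N v u))]].

Definition anisconn A : set anisfield := [set Gam |
  [/\ (forall v, ~ A v -> Gam v = fun _ _ => 0),
      (forall v, A v -> (forall u, linear (Gam v u)) /\
                        (forall u, linear (Gam v ^~ u))),
      (forall i u1 u2,
         smooth_on (coord_dom A i) (fun z => christoffel i Gam z u1 u2)) &
      (forall v lambda, A v -> 0 < lambda -> Gam (hmul lambda v) = Gam v)]].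

(* The anisotropic tensors of type (1, s), homogeneous of degree alpha. *)
Definition htens A (s : nat) (alpha : int) : set (tensfield s) := [set T |
  [/\ (forall v, ~ A v -> T v = fun=> 0),
      (forall v, A v -> multilinear (T v)),
      (forall i w, smooth_on (coord_dom A i) (fun z => tens_comp i T z w)) &
      (forall i z lambda w, coord_dom A i z -> 0 < lambda ->
         tens_comp i T (z.1, lambda *: z.2) w
         = lambda ^ alpha *: tens_comp i T z w)]].

(* Contraction of the last index with the Liouville field, whose value at v
   is v itself. *)
Definition iotaC (s : nat) (S : tensfield s.+1) : tensfield s := fun v w =>
  S v (fun k => oapp w v.2 (unlift ord_max k)).

Definition ker_iotaC A (s : nat) (alpha : int) : set (tensfield s.+1) :=
  [set S | htens A alpha S /\ iotaC S = fun _ _ => 0].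

(* The coordinate expressions below are evaluated at v in the natural chart
   [xTM (apref xTM v)], where tangent vectors are their own components; the
   derivatives f_{.k} u^k are the directional ones along (0, u). *)

Definition ddot_spr A (G : vfield) : nlfield := fun v u =>
  let i := apref xTM v in
  if v \in A
  then (u, - 'D_(0, u) (spray_coef i G) (cmap (xTM i) v))
  else 0.

Definition iota_spr A (N : nlfield) : vfield := fun v =>
  let i := apref xTM v in
  if v \in A
  then (v.2, - nl_coef i N (cmap (xTM i) v) v.2)
  else 0.

Definition ddot_nl A (N : nlfield) : anisfield := fun v u1 u2 =>
  let i := apref xTM v in
  if v \in A
  then 'D_(0, u2) (fun z => nl_coef i N z u1) (cmap (xTM i) v)
  else 0.

Definition iota_nl A (Gam : anisfield) : nlfield := fun v u =>
  let i := apref xTM v in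
  if v \in A
  then (u, - christoffel i Gam (cmap (xTM i) v) u v.2)
  else 0.

Definition ddot_anis A (Gam : anisfield) : tensfield 3 := fun v w =>
  let i := apref xTM v in
  if v \in A
  then 'D_(0, w 2) (fun z => christoffel i Gam z (w 0) (w 1)) (cmap (xTM i) v)
  else 0.

(* N - J has coefficients N^i_j + J^i_j. *)
Definition nl_sub (N : nlfield) (J : tensfield 1) : nlfield := fun v u =>
  N v u - (0, J v (fun=> u)).

Definition nl_add (N : nlfield) (J : tensfield 1) : nlfield :=
  nl_sub N (fun v w => - J v w).

Definition nl_diff (N N' : nlfield) : tensfield 1 := fun v w =>
  (N v (w 0) - N' v (w 0)).2.

Definition anis_add (Gam : anisfield) (P : tensfield 2) : anisfield :=
  fun v u1 u2 => Gam v u1 u2 + P v (tnth [tuple u1; u2]).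

Definition anis_diff (Gam Gam' : anisfield) : tensfield 2 := fun v w =>
  Gam v (w 0) (w 1) - Gam' v (w 0) (w 1).

End Anisotropic.

Arguments vfield {R n} M.
Arguments nlfield {R n} M.
Arguments anisfield {R n} M.
Arguments tensfield {R n} M s.

(* Main.v *)
(* Each identity is Euler's theorem on a fibre: a function homogeneous of degree
   k on the cone A_p, differentiated at y in the direction y, gives k times
   itself, with k = 2 for spray coefficients, k = 1 for those of nonlinear
   connections and k = 0 for Christoffel symbols. The decompositions follow
   formally, since iota vanishes exactly on the differences lying in the kernel
   of iota_C.
   The values of sections are read in the preferred chart at each point, so the
   work lies in showing that the coordinate formulas for the operators hold in
   every natural chart. On a fibre only one change of chart tau matters, and the
   coefficients transform by Dtau together with terms in D^2 tau; comparing the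
   latter requires the symmetry of second differentials. Smoothness is then
   immediate in each chart. *)

Require Import Defs.
From HB Require Import structures.
From mathcomp Require Import all_boot all_order all_algebra.
From mathcomp Require Import all_classical all_reals all_analysis.
From mathcomp Require Import ring.

Set Implicit Arguments.
Unset Strict Implicit.
Unset Printing Implicit Defensive.
Import Order.TTheory GRing.Theory Num.Theory.
Import numFieldNormedType.Exports.
Local Open Scope classical_set_scope.
Local Open Scope ring_scope.

(** Charts and sections are total functions whose laws hold only on open sets, so an equation
    between them may be differentiated only once it is known near the point. This is why
    differentials are first shown to depend on germs alone, and why A has to be open in each fibre.
    Smoothness is given for fixed vector arguments, whereas the operators insert the point y itself.
    Expanding y in the standard basis ([linear_sum_coord]) turns such an evaluation into a finite
    sum of coordinates times functions already under control. A differential is linear in its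
    direction by type, but [transition2] has a second vector slot, inside the inner differential.
    Symmetry of second differentials supplies linearity there, and it also matches the inhomogeneous
    terms, which occur with their slots in different orders. *)

Lemma linear_scale {R : nzRingType} {V W : lmodType R} (f : V -> W) a u :
  linear f -> f (a *: u) = a *: f u.
Proof.
move=> fl; pose fM := GRing.isLinear.Build _ _ _ _ _ fl.
pose fL : {linear V -> W} := HB.pack f fM.
by rewrite -[f]/(fL : _ -> _) linearZ.
Qed.

Lemma coord_linear {R : realType} m n i j :
  linear (fun N : 'M[R]_(m, n) => N i j : R).
Proof. by move=> a M N; rewrite !mxE. Qed.

Lemma linear_sum_coord {R : nzRingType} {n : nat} {W : lmodType R}
    (L : 'rV[R]_n -> W) (u : 'rV[R]_n) : linear L ->
  L u = \sum_(j < n) u ord0 j *: L (delta_mx 0 j).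
Proof.
move=> Ll; pose LM := GRing.isLinear.Build _ _ _ _ _ Ll.
pose LL : {linear 'rV[R]_n -> W} := HB.pack L LM.
rewrite -[L]/(LL : _ -> _) {1}[u]row_sum_delta linear_sum.
by apply: eq_bigr => j _; rewrite linearZ.
Qed.

(** * Differentials as germs; product and sum rules *)

Section Differentials.
Context {R : realType} {V W : normedModType R}.
Implicit Types (f g df : V -> W) (k dk : V -> R).

(** Such a function is its own little-o remainder, so uniqueness of the differential gives 0.
    Locality in general follows by subtracting. *)
Lemma near0_is_diff f (x : V) : (\near x, f x = 0) -> is_diff x f 0.
Proof.
move=> f0; have fx0 : f x = 0 by exact: nbhs_singleton f0.
have fo : f \o shift x = cst (f x) + (\0 : {linear V -> W}) +o_ 0 id.
  apply/eqaddoP => _/posnumP[e]; rewrite near_simpl fx0.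
  have : \forall y \near 0, f (y + x) = 0.
    by move: f0; rewrite [\forall z \near _, _ = 0](near_shift 0) subr0.
  apply: filterS => y /= fy0.
  by rewrite !fctE /= fy0 /cst !(addr0, oppr0) normr0 mulr_ge0.
have df0 : 'd f x = (\0 : {linear V -> W}) :> (V -> W).
  by apply: diff_unique => //; exact: cst_continuous.
apply: DiffDef; last by rewrite df0.
by apply/diff_locallyP; rewrite df0; split=> //; exact: cst_continuous.
Qed.

Lemma near_eq_is_diff f g df (x : V) : (\near x, f x = g x) ->
  is_diff x f df -> is_diff x g df.
Proof.
move=> fg dfx; have dgf : is_diff x (g - f) 0.
  apply: near0_is_diff; apply: filterS fg => y fgy.
  by rewrite !fctE fgy subrr.
have -> : g = f + (g - f) by rewrite addrC subrK.
by apply: is_diff_eq (is_diffD dfx dgf) _; rewrite addr0.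
Qed.

Lemma is_diffE f df (x v : V) : is_diff x f df -> 'd f x v = df v.
Proof. by move=> fdf; rewrite diff_val. Qed.

Lemma near_eq_derive_diff f g df (x v : V) : (\near x, g x = f x) ->
  is_diff x f df -> 'D_v g x = df v.
Proof.
move=> gf fdf; have gdf : is_diff x g df.
  by apply: near_eq_is_diff fdf; apply: filterS gf => y.
by rewrite deriveE ?(is_diffE v gdf).
Qed.

Lemma near_eq_differentiable f g (x : V) : (\near x, f x = g x) ->
  differentiable f x -> differentiable g x.
Proof. by move=> fg /differentiableP /(near_eq_is_diff fg) []. Qed.

Lemma near_eq_diff f g (x v : V) : (\near x, f x = g x) ->
  differentiable f x -> 'd f x v = 'd g x v.
Proof.
move=> fg df.
exact: esym (is_diffE v (near_eq_is_diff fg (differentiableP df))).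
Qed.

Lemma linear_is_diff f (x : V) : linear f -> continuous f -> is_diff x f f.
Proof.
move=> lf cf; pose fM := GRing.isLinear.Build _ _ _ _ _ lf.
pose fL : {linear V -> W} := HB.pack f fM.
by apply: DiffDef; [exact: (@linear_differentiable _ _ _ fL)
                   |exact: (@diff_lin _ _ _ fL)].
Qed.

(** The Leibniz rule, read off from the differential of the bilinear map (r, w) to r w. *)
Lemma is_diff_scale k f dk df (x : V) : is_diff x k dk -> is_diff x f df ->
  is_diff x (fun y => k y *: f y) (fun v => k x *: df v + dk v *: f x).
Proof.
move=> dkx dfx; pose B (r : R) (w : W) := r *: w.
have Bbil : bilinear_for (GRing.Scale.Law.clone _ _ *:%R _)
                         (GRing.Scale.Law.clone _ _ *:%R _) B.
  split=> [w|r] a u v.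
    by rewrite -[RHS]/(a *: (u *: w) + v *: w) scalerA -scalerDl.
  by rewrite -[RHS]/(a *: (r *: u) + r *: v) !scalerA mulrC -scalerA -scalerDr.
pose BM := bilinear_isBilinear.Build R R W W _ _ B Bbil.
pose BL : {bilinear R -> W -> W} := HB.pack B BM.
have Bc : continuous (fun p => BL p.1 p.2) by exact: scale_continuous.
have dB : is_diff (k x, f x) (fun p => BL p.1 p.2)
    (fun p => BL (k x) p.2 + BL p.1 (f x)).
  by apply: DiffDef; [exact: differentiable_bilin|rewrite diff_bilin].
exact: (@is_diff_comp _ _ _ _ (fun y => (k y, f y)) _ _ _ _
  (is_diff_pair dkx dfx) dB).
Qed.

Lemma is_diff_sum n (F dF : 'I_n -> V -> W) (x : V) :
  (forall i, is_diff x (F i) (dF i)) ->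
  is_diff x (fun y => \sum_(i < n) F i y) (fun v => \sum_(i < n) dF i v).
Proof.
elim: n F dF => [|n IH] F dF FdF.
  rewrite (_ : (fun y => _) = cst 0); last first.
    by apply/funext => y; rewrite big_ord0.
  by apply: is_diff_eq; apply/funext => v; rewrite big_ord0.
have -> : (fun y => \sum_(i < n.+1) F i y) =
    (fun y => \sum_(i < n) F (widen_ord (leqnSn n) i) y) + F ord_max.
  by apply/funext => y; rewrite big_ord_recr.
apply: is_diff_eq (is_diffD (IH _ _ (fun i => FdF _)) (FdF ord_max)) _.
by apply/funext => v; rewrite big_ord_recr.
Qed.

End Differentials.

Lemma is_diff_fst {R : realType} {V W : normedModType R} (z : V * W) :
  is_diff z fst fst.
Proof. by apply: linear_is_diff => // p; exact: cvg_fst. Qed.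

Lemma is_diff_snd {R : realType} {V W : normedModType R} (z : V * W) :
  is_diff z snd snd.
Proof. by apply: linear_is_diff => // p; exact: cvg_snd. Qed.

(** * Calculus of C^k maps on an open set *)

Section Smoothness.
Context {R : realType} {V W : normedModType R} (U : set V) (Uopen : open U).
Implicit Types (f g : V -> W) (k : V -> R) (m : nat).

(** Openness of U upgrades equality on U to equality near each point, so the differentials agree on
    U as well and the induction continues. *)
Lemma eq_Ck m f g : (forall x, U x -> f x = g x) -> Ck m U f -> Ck m U g.
Proof.
have nearU f' g' : (forall x, U x -> f' x = g' x) ->
    forall x, U x -> \near x, f' x = g' x.
  by move=> fg x Ux; apply: filterS (open_nbhs_nbhs (conj Uopen Ux)).
elim: m f g => [|m IH] f g fg /=.
  move=> fc x Ux; rewrite /prop_for /continuous_at -fg//.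
  by apply: cvg_trans (fc x Ux); apply: near_eq_cvg; apply: (nearU _ _ fg).
move=> [df dfC]; split=> [x Ux|v].
  exact: near_eq_differentiable (nearU _ _ fg _ Ux) (df x Ux).
apply: IH (dfC v) => x Ux.
exact: near_eq_diff (nearU _ _ fg _ Ux) (df x Ux).
Qed.

Lemma Ck_succ m f : Ck m.+1 U f -> Ck m U f.
Proof.
elim: m f => [|m IH] f [df dfC] /=.
  by move=> x /df; exact: differentiable_continuous.
by split=> // v; exact/IH/dfC.
Qed.

Lemma Ck_cst m (w : W) : Ck m U (fun=> w).
Proof.
elim: m w => [|m IH] w /=; first by move=> x _; exact: cst_continuous.
split=> [x _|v]; first exact: differentiable_cst.
by apply: eq_Ck (IH 0) => x _; rewrite (@diff_cst _ V W w x).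
Qed.

Lemma CkD m f g : Ck m U f -> Ck m U g -> Ck m U (fun x => f x + g x).
Proof.
elim: m f g => [|m IH] f g /=.
  by move=> fc gc x Ux; apply: continuousD; [exact: fc|exact: gc].
move=> [df dfC] [dg dgC]; split=> [x Ux|v].
  by apply: differentiableD; [exact: df|exact: dg].
apply: eq_Ck (IH _ _ (dfC v) (dgC v)) => x Ux.
exact/esym/(is_diffE v (is_diffD (differentiableP (df x Ux))
                                 (differentiableP (dg x Ux)))).
Qed.

End Smoothness.

Section SmoothnessScale.
Context {R : realType} {V W : normedModType R} (U : set V) (Uopen : open U).

Lemma Ck_scale m (k : V -> R) (f : V -> W) :
  Ck m U k -> Ck m U f -> Ck m U (fun x => k x *: f x).
Proof.
elim: m k f => [|m IH] k f.
  by move=> kc fc x Ux; apply: continuousZ; [exact: kc|exact: fc].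
move=> kC fC; have [dk dkC] := kC; have [df dfC] := fC; split=> [x Ux|v].
  by have [] := is_diff_scale (differentiableP (dk x Ux))
    (differentiableP (df x Ux)).
apply: (@eq_Ck _ _ _ U Uopen m
    (fun x => k x *: 'd f x v + 'd k x v *: f x)) => [x Ux|].
  exact/esym/(is_diffE v (is_diff_scale (differentiableP (dk x Ux))
                                        (differentiableP (df x Ux)))).
exact: (CkD Uopen (IH _ _ (Ck_succ kC) (dfC v)) (IH _ _ (dkC v) (Ck_succ fC))).
Qed.

End SmoothnessScale.

Section SmoothnessComp.
Context {R : realType} {V W W' : normedModType R} (U : set V) (Uopen : open U).

Lemma is_diff_lcomp (L : W -> W') (f df : V -> W) (x : V) :
  linear L -> continuous L -> is_diff x f df -> is_diff x (L \o f) (L \o df).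
Proof.
by move=> Ll Lc fdf; exact: is_diff_comp fdf (linear_is_diff (f x) Ll Lc).
Qed.

Lemma diff_lcomp (L : W -> W') (f : V -> W) (x v : V) :
  linear L -> continuous L -> differentiable f x ->
  'd (fun z => L (f z)) x v = L ('d f x v).
Proof.
by move=> Ll Lc /differentiableP df; exact: is_diffE (is_diff_lcomp Ll Lc df).
Qed.

Lemma Ck_lcomp m (L : W -> W') (f : V -> W) : linear L -> continuous L ->
  Ck m U f -> Ck m U (fun x => L (f x)).
Proof.
move=> Ll Lc; elim: m f => [|m IH] f /=.
  by move=> fc x Ux; apply: continuous_comp; [exact: fc|exact: Lc].
move=> [df dfC]; split=> [x Ux|v].
  by have [] := is_diff_lcomp Ll Lc (differentiableP (df x Ux)).
apply: (@eq_Ck _ _ _ U Uopen m (fun x => L ('d f x v))) (IH _ (dfC v)) => x Ux.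
exact/esym/diff_lcomp/df.
Qed.

Lemma Ck_linear m (L : V -> W) : linear L -> continuous L -> Ck m U L.
Proof.
move=> Ll Lc; case: m => [|m] /=; first by move=> x _; exact: Lc.
split=> [x _|v]; first by have [] := linear_is_diff x Ll Lc.
apply: (@eq_Ck _ _ _ U Uopen m (fun=> L v)) (Ck_cst Uopen m (L v)) => x _.
exact/esym/(is_diffE v (linear_is_diff x Ll Lc)).
Qed.

Lemma Ck_sum m n (F : 'I_n -> V -> W) :
  (forall i, Ck m U (F i)) -> Ck m U (fun x => \sum_(i < n) F i x).
Proof.
move=> FC; elim: n F FC => [|n IH] F FC.
  apply: (@eq_Ck _ _ _ U Uopen m (fun=> 0)) (Ck_cst Uopen m 0) => x _.
  by rewrite big_ord0.
apply: (@eq_Ck _ _ _ U Uopen m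
    (fun x => \sum_(i < n) F (widen_ord (leqnSn n) i) x + F ord_max x))
    => [x _|].
  by rewrite big_ord_recr.
by apply: (CkD Uopen) (FC _); apply: IH => i; exact: FC.
Qed.

End SmoothnessComp.

(** * Symmetry of the second differential *)

Section SecondDifferential.
Context {R : realType} {V : normedModType R} (U : set V) (Uopen : open U).

Lemma is_derive_line (g : V -> R) (x u : V) (s : R) :
  differentiable g (x + s *: u) ->
  is_derive s 1 (fun r => g (x + r *: u)) ('d g (x + s *: u) u).
Proof.
move=> dg; have dl : is_diff s (fun r : R => x + r *: u) ( *:%R ^~ u).
  apply: is_diff_eq (is_diffD (is_diff_cst x s) (is_diff_scalel s u)) _.
  by rewrite add0r.
have dc := is_diff_comp dl (differentiableP dg).
have [dcd _] := dc; apply: DeriveDef; first exact/diff_derivable.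
by rewrite deriveE // (is_diffE (1 : R) dc) /= scale1r.
Qed.

(* The mean value theorem applied along u, then along v. The left-hand side is
   symmetric in u and v; this is what makes the second differential symmetric. *)
Lemma second_difference_mean_value (g : V -> R) (x u v : V) (h : R) :
  Ck 2 U g -> 0 < h ->
  (forall s t, s \in `[0, h] -> t \in `[0, h] -> U (x + s *: u + t *: v)) ->
  exists s t, [/\ s \in `[0, h], t \in `[0, h] &
    g (x + h *: u + h *: v) - g (x + h *: u) - (g (x + h *: v) - g x)
    = h * h * 'd (fun z => 'd g z u) (x + s *: u + t *: v) v].
Proof.
move=> [dg dgC] h0 inU.
have h_in : h \in `[0, h] by rewrite in_itv /= lexx ltW.
have o_in : 0 \in `[0, h] by rewrite in_itv /= lexx ltW.
have sub c : c \in `]0, h[ -> c \in `[0, h] by exact: subset_itv_oo_cc.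
pose phi s := g (x + h *: v + s *: u) - g (x + s *: u).
have dphi s : s \in `[0, h] -> is_derive s 1 phi
    ('d g (x + s *: u + h *: v) u - 'd g (x + s *: u) u).
  move=> sh; have H1 := inU _ _ sh h_in; have := inU _ _ sh o_in.
  rewrite scale0r addr0 => H0; rewrite addrAC in H1 *.
  exact: is_deriveB (is_derive_line (dg _ H1)) (is_derive_line (dg _ H0)).
have cphi : {within `[0, h], continuous phi}.
  by apply: derivable_within_continuous => s /dphi [].
have [s sh phih] := MVT h0 (fun s sh => dphi s (sub _ sh)) cphi.
pose psi t := 'd g (x + s *: u + t *: v) u.
have dpsi t : t \in `[0, h] -> is_derive t 1 psi
    ('d (fun z => 'd g z u) (x + s *: u + t *: v) v).
  move=> th; apply: is_derive_line; apply: (dgC u).1.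
  by apply: inU => //; exact: sub.
have cpsi : {within `[0, h], continuous psi}.
  by apply: derivable_within_continuous => t /dpsi [].
have [t th psih] := MVT h0 (fun t th => dpsi t (sub _ th)) cpsi.
exists s, t; split; [exact: sub|exact: sub|].
have := phih; rewrite /phi !scale0r !addr0 subr0 [_ + h *: v + _]addrAC => ->.
by move: psih; rewrite /psi scale0r addr0 subr0 => ->; rewrite -mulrA mulrC.
Qed.

(** The mean value formulas for (u, v) and for (v, u) evaluate the two mixed differentials at
    possibly different points near x, with equal results. Both are continuous at x, so each costs at
    most e / 2. *)
Lemma diff2_sym_real (g : V -> R) (x u v : V) : Ck 2 U g -> U x ->
  'd (fun z => 'd g z u) x v = 'd (fun z => 'd g z v) x u.
Proof.
move=> gC Ux; apply/eqP; rewrite -subr_eq0 -normr_le0.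
apply/ler_addgt0Pr => e e0; rewrite add0r.
have c1 : {for x, continuous (fun z => 'd (fun z => 'd g z u) z v)}.
  by have [_ /(_ u) [_ /(_ v)]] := gC; apply.
have c2 : {for x, continuous (fun z => 'd (fun z => 'd g z v) z u)}.
  by have [_ /(_ v) [_ /(_ u)]] := gC; apply.
have e20 : 0 < e / 2 by rewrite divr_gt0.
have /cvgrPdist_lt/(_ _ e20) n1 := c1.
have /cvgrPdist_lt/(_ _ e20) n2 := c2.
have n3 : \forall z \near x, U z by exact: open_nbhs_nbhs.
have [d /= d0 dP] := (nbhs_ballP _ _).1 (filterI (filterI n1 n2) n3).
(* The summand 1 makes [c] positive even when u = v = 0 and makes the estimate strict: the
   parallelogram with sides h u and h v stays within h (|u| + |v|) < h c = d of x. *)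
pose c := `|u| + `|v| + 1; have c0 : 0 < c by rewrite ltr_wpDl ?addr_ge0.
pose h := d / c; have h0 : 0 < h by rewrite divr_gt0.
have near_pt (w w' : V) s t : `|w| + `|w'| + 1 = c ->
    s \in `[0, h] -> t \in `[0, h] -> ball x d (x + s *: w + t *: w').
  move=> wc; rewrite !in_itv /= => /andP[s0 sh] /andP[t0 th].
  rewrite -ball_normE /= -addrA opprD addNKr normrN.
  apply: le_lt_trans (ler_normD _ _) _; rewrite !normrZ !ger0_norm//.
  apply: (@le_lt_trans _ _ (h * (`|w| + `|w'|))).
    by rewrite mulrDr lerD// ler_wpM2r.
  by rewrite -[ltRHS](divfK (lt0r_neq0 c0)) ltr_pM2l// -wc ltrDl.
have [s [t [sh th E1]]] := second_difference_mean_value gC h0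
  (fun s t sh th => (dP _ (near_pt u v s t erefl sh th)).2).
have vuc : `|v| + `|u| + 1 = c by rewrite /c [X in X + 1]addrC.
have [s' [t' [sh' th' E2]]] := second_difference_mean_value gC h0
  (fun s t sh th => (dP _ (near_pt v u s t vuc sh th)).2).
have E : 'd (fun z => 'd g z u) (x + s *: u + t *: v) v =
         'd (fun z => 'd g z v) (x + s' *: v + t' *: u) u.
  apply: (@mulfI _ (h * h)); first by rewrite mulf_neq0 ?gt_eqF.
  by rewrite -E1 -E2 [x + h *: v + _]addrAC; ring.
have [[D1 _] _] := dP _ (near_pt u v s t erefl sh th).
have [[_ D2] _] := dP _ (near_pt v u s' t' vuc sh' th').
move: D1 D2; rewrite /= E.
set A := 'd _ x v; set B := 'd _ x u; set C := 'd _ _ _ => D1 D2.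
by rewrite -(subrK C A) -addrA (le_trans (ler_normD _ _))// [`|C - B|]distrC
  [leRHS]splitr lerD// ltW.
Qed.

(** The mean value theorem needs real values. A coordinate is linear and continuous, hence commutes
    with both differentials. *)
Lemma diff2_sym n (f : V -> 'rV[R]_n) (x u v : V) : Ck 2 U f -> U x ->
  'd (fun z => 'd f z u) x v = 'd (fun z => 'd f z v) x u.
Proof.
move=> fC Ux; apply/rowP => j.
pose L (w : 'rV[R]_n) : R := w ord0 j.
have Ll : linear L by exact: coord_linear.
have Lc : continuous L by exact: coord_continuous.
have dE w w' : 'd (fun z => 'd (fun z' => L (f z')) z w) x w'
    = L ('d (fun z => 'd f z w) x w').
  have [df dfC] := fC; have [dwf _] := dfC w.
  rewrite -(diff_lcomp w' Ll Lc (dwf x Ux)).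
  apply/esym/near_eq_diff; last first.
    by have [] := is_diff_lcomp Ll Lc (differentiableP (dwf x Ux)).
  apply: filterS (open_nbhs_nbhs (conj Uopen Ux)) => z Uz.
  exact/esym/diff_lcomp/df.
rewrite -[LHS]/(L _) -[RHS]/(L _) -!dE.
by apply: diff2_sym_real Ux; exact: (Ck_lcomp Uopen Ll Lc fC).
Qed.

End SecondDifferential.

(** * Changes of chart on the base manifold *)

Section Charts.
Context {R : realType} {n : nat} {M : smoothManifold 'rV[R]_n}.
Local Notation E := 'rV[R]_n.
Local Notation xM := (matlas M).
Local Notation xTM := (tangent_atlas (matlas M)).
Implicit Types (i j k : aidx xM) (x : M) (v : M * E).

(** Only the images of whole charts are open by definition; the overlap is cut out of one by
    continuity of the inverse chart and openness of the domain of j. *)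
Lemma overlap_open i j : open (cmap (xM i) @` (cdom (xM i) `&` cdom (xM j))).
Proof.
rewrite openE => _ [x [xi xj] <-].
have zi : (cmap (xM i) @` cdom (xM i)) (cmap (xM i) x) by exists x.
have := mcinv_continuous zi; rewrite /prop_for /continuous_at mcmapK// => cx.
have nj : \forall z \near cmap (xM i) x, cdom (xM j) (cinv (xM i) z).
  by apply: cx; apply: open_nbhs_nbhs; split; [exact: mcdom_open|].
have ni := open_nbhs_nbhs (conj (mcodom_open i) zi).
apply: filterS (filterI nj ni) => z [yj [y yi zE]].
by move: yj; rewrite -zE mcmapK// => yj; exists y.
Qed.

Lemma transition_cmap i j x : cdom (xM i) x ->
  transition (a := xM) i j (cmap (xM i) x) = cmap (xM j) x.
Proof. by move=> xi; rewrite /transition /= mcmapK. Qed.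

Lemma transition_differentiable i j x : cdom (xM i) x -> cdom (xM j) x ->
  differentiable (transition (a := xM) i j) (cmap (xM i) x).
Proof. by move=> xi xj; apply: (msmooth i j 1).1; exists x. Qed.

Lemma near_overlap i j x : cdom (xM i) x -> cdom (xM j) x ->
  \forall z \near cmap (xM i) x,
    (cmap (xM i) @` (cdom (xM i) `&` cdom (xM j))) z.
Proof.
by move=> xi xj; apply: open_nbhs_nbhs; split; [exact: overlap_open|exists x].
Qed.

(** Stated near the point and not only at it, so that it can be differentiated once more in
    [transition2_pref]. *)
Lemma near_diff_transition_id i x u : cdom (xM i) x ->
  \forall z \near cmap (xM i) x, 'd (transition (a := xM) i i) z u = u.
Proof.
move=> xi; apply: filterS (near_overlap xi xi) => _ [y [yi _] <-].
rewrite -(@near_eq_diff _ _ _ id)//; first exact: is_diffE u (is_diff_id _).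
apply: filterS (near_overlap yi yi) => _ [x' [xi' _] <-].
by rewrite transition_cmap.
Qed.

Lemma diff_transition_id i x u : cdom (xM i) x ->
  'd (transition (a := xM) i i) (cmap (xM i) x) u = u.
Proof.
by move=> xi; exact: (nbhs_singleton (near_diff_transition_id u xi)).
Qed.

(** The cocycle rule: the chain rule applied to an identity of transitions that holds near the
    point. *)
Lemma diff_transition_comp i j k x u :
  cdom (xM i) x -> cdom (xM j) x -> cdom (xM k) x ->
  'd (transition (a := xM) j k) (cmap (xM j) x)
    ('d (transition (a := xM) i j) (cmap (xM i) x) u)
  = 'd (transition (a := xM) i k) (cmap (xM i) x) u.
Proof.
move=> xi xj xk.
have dij := differentiableP (transition_differentiable xi xj).
have djk := differentiableP (transition_differentiable xj xk).
rewrite -(transition_cmap j xi) in djk *.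
rewrite -[LHS](is_diffE u (is_diff_comp dij djk)); apply: near_eq_diff.
  apply: filterS (near_overlap xi xj) => _ [y [yi yj] <-] /=.
  by rewrite !transition_cmap.
by have [] := is_diff_comp dij djk.
Qed.

Lemma tcoordK i x : cdom (xM i) x ->
  cancel (tcoord (a := xM) i x) (tvec (a := xM) i x).
Proof.
move=> xi u; rewrite /tvec /tcoord diff_transition_comp ?diff_transition_id//;
  exact: mpref.
Qed.

Lemma tvecK i x : cdom (xM i) x ->
  cancel (tvec (a := xM) i x) (tcoord (a := xM) i x).
Proof.
move=> xi u; rewrite /tvec /tcoord diff_transition_comp ?diff_transition_id//;
  exact: mpref.
Qed.

Lemma tcoord_pref x u : tcoord (a := xM) (apref xM x) x u = u.
Proof. by rewrite /tcoord diff_transition_id//; exact: mpref. Qed.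

(** Linearity is built into the type of ['d], so x may lie outside the chart; continuity below does
    rest on differentiability there. *)
Lemma tcoord_linear i x : linear (tcoord (a := xM) i x).
Proof. exact: linearP. Qed.

Lemma tcoord_continuous i x : cdom (xM i) x ->
  continuous (tcoord (a := xM) i x).
Proof.
move=> xi; apply: diff_continuous; apply: transition_differentiable => //.
exact: mpref.
Qed.

Lemma transition2_sym i x (u w : E) : cdom (xM i) x ->
  transition2 (a := xM) i x u w = transition2 (a := xM) i x w u.
Proof.
move=> xi; have xp : (cmap (xM (apref xM x)) @`
    (cdom (xM (apref xM x)) `&` cdom (xM i))) (cmap (xM (apref xM x)) x).
  by exists x => //; split=> //; exact: mpref.
exact: (diff2_sym (@overlap_open _ _) u w (msmooth _ i 2%N) xp).
Qed.

Lemma transition2_continuous i x u : cdom (xM i) x ->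
  continuous (transition2 (a := xM) i x u).
Proof.
move=> xi; apply: diff_continuous.
have [_ /(_ u) [d _]] := msmooth (apref xM x) i 2%N.
by apply: d; exists x => //; split=> //; exact: mpref.
Qed.

Lemma transition2_linearr i x u : linear (transition2 (a := xM) i x u).
Proof. exact: linearP. Qed.

(** The left vector sits inside the inner differential; symmetry moves it to the direction, where
    linearity is automatic. *)
Lemma transition2_linearl i x u : cdom (xM i) x ->
  linear (transition2 (a := xM) i x ^~ u).
Proof.
move=> xi a y z; rewrite !(transition2_sym _ u xi).
exact: transition2_linearr.
Qed.

(** The transition is the identity near the point, so its first differential is locally constant.
    Hence in the preferred chart the coordinate formulas carry no second order term. *)
Lemma transition2_pref x (u w : E) :
  transition2 (a := xM) (apref xM x) x u w = 0.
Proof.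
rewrite /transition2 -(@near_eq_diff _ _ _ (cst u)).
- by rewrite diff_cst.
- by apply: filterS (near_diff_transition_id u (mpref x)) => z ->.
- exact: differentiable_cst.
Qed.

End Charts.

(** * Natural charts of the tangent bundle *)

Section ApplyDifferential.
Context {R : realType} {n m : nat} (U : set 'rV[R]_n) (Uopen : open U).

(** Being C^2 gives information on df_x(w) for fixed w only. Expanding y in the basis reduces the
    joint differential of df_x(y) to the Leibniz rule for each coordinate. *)
Lemma is_diff_apply_diff (f : 'rV[R]_n -> 'rV[R]_m) (z : 'rV[R]_n * 'rV[R]_n) :
  Ck 2 U f -> U z.1 ->
  is_diff z (fun y : 'rV[R]_n * 'rV[R]_n => 'd f (y.1) y.2)
    (fun xi : 'rV[R]_n * 'rV[R]_n =>
      'd (fun x => 'd f x z.2) (z.1) xi.1 + 'd f (z.1) xi.2).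
Proof.
move=> fC Uz; have [_ dfC] := fC.
have -> : (fun y : 'rV[R]_n * 'rV[R]_n => 'd f (y.1) y.2) =
    (fun y => \sum_(j < n) y.2 ord0 j *: 'd f (y.1) (delta_mx 0 j)).
  by apply/funext => y; apply: linear_sum_coord; exact: linearP.
have dk j : is_diff z (fun y : 'rV[R]_n * 'rV[R]_n => y.2 ord0 j)
    (fun xi => xi.2 ord0 j).
  have cj := linear_is_diff z.2 (@coord_linear R 1 n ord0 j)
    (@coord_continuous _ _ _ ord0 j).
  exact: is_diff_comp (is_diff_snd z) cj.
have dF j : is_diff z
    (fun y : 'rV[R]_n * 'rV[R]_n => 'd f (y.1) (delta_mx 0 j))
    (fun xi => 'd (fun x => 'd f x (delta_mx 0 j)) (z.1) xi.1).
  have [dj _] := dfC (delta_mx 0 j).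
  exact: is_diff_comp (is_diff_fst z) (differentiableP (dj _ Uz)).
apply: is_diff_eq (is_diff_sum (fun j => is_diff_scale (dk j) (dF j))) _.
pose D y v := 'd (fun x => 'd f x y) (z.1) v.
have Dsym y v : D y v = D v y by exact: (diff2_sym Uopen).
apply/funext => xi /=; rewrite big_split /=; congr (_ + _); last first.
  by rewrite -linear_sum_coord//; exact: linearP.
(* [D] is linear in its last slot by type; symmetry puts the basis vector there, so that the sum
   folds back into one value of [D]. *)
transitivity (\sum_(j < n) z.2 ord0 j *: D xi.1 (delta_mx 0 j)).
  by apply: eq_bigr => j _; congr (_ *: _); exact: Dsym.
rewrite -linear_sum_coord; first exact: Dsym.
exact: linearP.
Qed.

End ApplyDifferential.

Section TangentCharts.
Context {R : realType} {n : nat} {M : smoothManifold 'rV[R]_n}.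
Local Notation E := 'rV[R]_n.
Local Notation xM := (matlas M).
Local Notation xTM := (tangent_atlas (matlas M)).
Implicit Types (i j : aidx xM) (x : M) (v : M * E) (z xi : E * E).

Lemma tangent_transition i j x (y : E) :
  cdom (xM i) x -> cdom (xM j) x ->
  transition (a := xTM) i j (cmap (xM i) x, y)
  = (cmap (xM j) x, 'd (transition (a := xM) i j) (cmap (xM i) x) y).
Proof.
move=> xi xj; rewrite /transition /= mcmapK//; congr pair.
exact: (diff_transition_comp y xi (mpref x) xj).
Qed.

Lemma tangent_cinv_cmap i v : cdom (xM i) v.1 ->
  cinv (xTM i) (cmap (xTM i) v) = v.
Proof. by move=> vi /=; rewrite mcmapK// tcoordK// -surjective_pairing. Qed.

Lemma near_fst (P : E -> Prop) z : (\forall x \near z.1, P x) ->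
  \forall y \near z, P y.1.
Proof. by move=> Pz; exact: (@cvg_fst _ _ (nbhs z.1) (nbhs z.2) _ _ Pz). Qed.

(** The differential of (x, y) to (tau x, Dtau y). Its term in D^2 tau is the source of the
    inhomogeneous terms for sprays and nonlinear connections. *)
Lemma tcoord_tangent i v xi : cdom (xM i) v.1 ->
  tcoord (a := xTM) i v xi
  = (tcoord (a := xM) i v.1 xi.1,
     transition2 (a := xM) i v.1 v.2 xi.1 + tcoord (a := xM) i v.1 xi.2).
Proof.
move=> vi; have vp := mpref v.1; set p := apref xM v.1 in vp.
have vE : cmap (xTM p) v = (cmap (xM p) v.1, v.2) by rewrite /= tcoord_pref.
pose f := transition (a := xM) p i.
have df := differentiableP (transition_differentiable vp vi).
have ov : (cmap (xM p) @` (cdom (xM p) `&` cdom (xM i))) (cmap (xM p) v.1).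
  by exists v.1.
have d1 : is_diff (cmap (xM p) v.1, v.2) (f \o fst)
   ('d f (cmap (xM p) v.1) \o fst).
  exact: is_diff_comp (is_diff_fst (cmap (xM p) v.1, v.2)) df.
have d2 := is_diff_apply_diff (@overlap_open _ _ _ _ _)
  (z := (cmap (xM p) v.1, v.2)) (msmooth p i 2%N) ov.
have near_eq : \forall y \near (cmap (xM p) v.1, v.2),
    (f y.1, 'd f (y.1) y.2) = transition (a := xTM) p i y.
  apply: filterS (near_fst (z := (_, _)) (near_overlap vp vi))
    => -[_ y] /= [x [xp xi'] <-].
  by rewrite tangent_transition// /f transition_cmap.
rewrite /tcoord -/p vE.
exact: (is_diffE xi (near_eq_is_diff near_eq (is_diff_pair d1 d2))).
Qed.

Lemma mdiff_fst v xi : mdiff xTM xM fst v xi = xi.1.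
Proof.
have vp := mpref v.1.
have near_eq : \forall y \near cmap (xTM (apref xTM v)) v, y.1 =
    (cmap (xM (apref xM v.1)) \o fst \o cinv (xTM (apref xTM v))) y.
  apply: filterS (near_fst (z := (_, _)) (near_overlap vp vp))
    => -[_ y] /= [x [xp _] <-].
  by rewrite mcmapK.
exact: (is_diffE xi (near_eq_is_diff near_eq (is_diff_fst _))).
Qed.

(** Scaling fixes the base point, so source and target use the same natural chart, in which
    [hmul lambda] is linear on fibres. *)
Lemma mdiff_hmul lambda v xi :
  mdiff xTM xTM (hmul lambda) v xi = (xi.1, lambda *: xi.2).
Proof.
have vp := mpref v.1.
have near_eq : \forall y \near cmap (xTM (apref xTM v)) v,
    (y.1, lambda *: y.2) =
    (cmap (xTM (apref xTM v)) \o hmul lambda \o cinv (xTM (apref xTM v))) y.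
  apply: filterS (near_fst (z := (_, _)) (near_overlap vp vp))
    => -[_ y] /= [x [xp _] <-].
  rewrite mcmapK//; congr pair.
  by rewrite /tcoord linearZ -/(tcoord (a := xM) _ _ _) tvecK.
exact: (is_diffE xi (near_eq_is_diff near_eq
  (is_diff_pair (is_diff_fst _) (is_diffZ lambda (is_diff_snd _))))).
Qed.

End TangentCharts.

(** * Homogeneous functions and diagonal values of bilinear maps *)

Section Homogeneous.
Context {R : realType} {V W : normedModType R}.
Implicit Types (f : V -> W) (x u : V).

(** Both sides of the homogeneity law are differentiated in l at l = 1, near which l stays
    positive. *)
Lemma euler_homogeneous f x (a : nat) : differentiable f x ->
  (forall l : R, 0 < l -> f (l *: x) = l ^+ a *: f x) ->
  'd f x x = a%:R *: f x.
Proof.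
move=> df fh; have df1 : differentiable f ((1 : R) *: x) by rewrite scale1r.
have d1 := is_diff_comp (is_diff_scalel (1 : R) x) (differentiableP df1).
have dX : differentiable (@GRing.exp R ^~ a) (1 : R).
  exact/derivable1_diffP/exprn_derivable.
have d2 := is_diff_scale (differentiableP dX) (is_diff_cst (f x) (1 : R)).
have near_eq : \forall l \near (1 : R), (f \o ( *:%R ^~ x)) l = l ^+ a *: f x.
  have : \forall l \near (1 : R), 0 < l by exact: lt_nbhsr.
  by apply: filterS => l; exact: fh.
have := is_diffE (1 : R) (near_eq_is_diff near_eq d1).
rewrite (is_diffE (1 : R) d2) /= !scale1r => <-.
rewrite -(deriveE (1 : R) dX) exp_derive expr1n scaler0 add0r.
congr (_ *: _).
exact: etrans (mulr1 _) (etrans (congr1 _ (expr1n _ _)) (mulr1 _)).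
Qed.

(** The factor is split as [l * c] so that [c] is the factor of the derivative, one degree lower: c
    is l for sprays, 1 for nonlinear connections and the inverse of l for anisotropic ones. The law
    is asked near x only, since it holds on A only. *)
Lemma diff_homogeneous f x u (l c : R) : l != 0 ->
  differentiable f x -> differentiable f (l *: x) ->
  (\forall y \near x, f (l *: y) = (l * c) *: f y) ->
  'd f (l *: x) u = c *: 'd f x u.
Proof.
move=> l0 df dfl near_eq; apply: (scalerI l0); rewrite scalerA.
have d1 := is_diff_comp (is_diff_scaler l x) (differentiableP dfl).
have d2 := is_diffZ (l * c) (differentiableP df).
rewrite -[RHS](is_diffE u d2) -linearZ.
exact: esym (is_diffE u (near_eq_is_diff near_eq d1)).
Qed.

End Homogeneous.

(** Applied to D^2 tau(y, y), the inhomogeneous term of a spray under change of chart. *)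
Lemma is_diff_bilinear_diag {R : realType} {n : nat} {W : normedModType R}
    (B : 'rV[R]_n -> 'rV[R]_n -> W) (y : 'rV[R]_n) :
  (forall u, linear (B u)) -> (forall u, linear (B ^~ u)) ->
  (forall u, continuous (B u)) ->
  is_diff y (fun y => B y y) (fun u => B y u + B u y).
Proof.
move=> Br Bl Bc.
have -> : (fun y => B y y) =
    (fun y => \sum_(j < n) y ord0 j *: B (delta_mx 0 j) y).
  by apply/funext => z; exact: (linear_sum_coord z (Bl z)).
have dk j := linear_is_diff y (@coord_linear R 1 n ord0 j)
  (@coord_continuous _ _ _ ord0 j).
have dF j : is_diff y (B (delta_mx 0 j)) (B (delta_mx 0 j)).
  by apply: linear_is_diff; [exact: Br|exact: Bc].
apply: is_diff_eq (is_diff_sum (fun j => is_diff_scale (dk j) (dF j))) _.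
apply/funext => u; rewrite big_split /=; congr (_ + _).
  exact: esym (linear_sum_coord y (Bl u)).
exact: esym (linear_sum_coord u (Bl y)).
Qed.

(** * Closure properties of smooth maps *)

Section SmoothnessDerivatives.
Context {R : realType} {V W : normedModType R} (U : set V) (Uopen : open U).

Lemma smooth_derive (f : V -> W) (v : V) :
  smooth_on U f -> smooth_on U (fun x => 'D_v f x).
Proof.
move=> fC m; have [df dfC] := fC m.+1.
apply: (@eq_Ck _ _ _ U Uopen m (fun x => 'd f x v)) (dfC v) => x Ux.
exact/esym/deriveE/df.
Qed.

Lemma eq_smooth (f g : V -> W) : (forall x, U x -> f x = g x) ->
  smooth_on U f -> smooth_on U g.
Proof. by move=> fg fC m; exact: (eq_Ck Uopen fg (fC m)). Qed.

Lemma smoothD (f g : V -> W) : smooth_on U f -> smooth_on U g ->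
  smooth_on U (fun x => f x + g x).
Proof. by move=> fC gC m; exact: (CkD Uopen (fC m) (gC m)). Qed.

Lemma smooth_cst (w : W) : smooth_on U (fun=> w).
Proof. by move=> m; exact: (Ck_cst Uopen). Qed.

End SmoothnessDerivatives.

Section SmoothnessLinear.
Context {R : realType} {V W W' : normedModType R} (U : set V) (Uopen : open U).

Lemma smooth_lcomp (L : W -> W') (f : V -> W) : linear L -> continuous L ->
  smooth_on U f -> smooth_on U (fun x => L (f x)).
Proof. by move=> Ll Lc fC m; exact: (Ck_lcomp Uopen Ll Lc (fC m)). Qed.

End SmoothnessLinear.

Section SmoothnessOperations.
Context {R : realType} {V : normedModType R} (U : set V) (Uopen : open U).

Lemma smoothZ (W : normedModType R) (c : R) (f : V -> W) :
  smooth_on U f -> smooth_on U (fun x => c *: f x).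
Proof.
apply: (smooth_lcomp Uopen); first exact: linearP.
exact: scaler_continuous.
Qed.

Lemma smoothN (W : normedModType R) (f : V -> W) :
  smooth_on U f -> smooth_on U (fun x => - f x).
Proof.
move=> fC; apply: (eq_smooth Uopen _ (smoothZ (-1) fC)) => x _.
by rewrite scaleN1r.
Qed.

Lemma smoothB (W : normedModType R) (f g : V -> W) :
  smooth_on U f -> smooth_on U g -> smooth_on U (fun x => f x - g x).
Proof. by move=> fC gC; exact: (smoothD Uopen fC (smoothN gC)). Qed.

Lemma smooth_snd (W W' : normedModType R) (f : V -> W * W') :
  smooth_on U f -> smooth_on U (fun x => (f x).2).
Proof. by apply: (smooth_lcomp Uopen) => // p; exact: cvg_snd. Qed.

Lemma smooth_pair (W W' : normedModType R) (f : V -> W) (g : V -> W') :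
  smooth_on U f -> smooth_on U g -> smooth_on U (fun x => (f x, g x)).
Proof.
move=> fC gC.
have lL : linear (fun w : W => (w, 0 : W')).
  by move=> a u w; congr pair; rewrite /= scaler0 addr0.
have lR : linear (fun w : W' => (0 : W, w)).
  by move=> a u w; congr pair; rewrite /= scaler0 addr0.
have cL : continuous (fun w : W => (w, 0 : W')).
  by move=> w; apply: cvg_pair; [exact: cvg_id|exact: cst_continuous].
have cR : continuous (fun w : W' => (0 : W, w)).
  by move=> w; apply: cvg_pair; [exact: cst_continuous|exact: cvg_id].
apply: (eq_smooth Uopen _ (smoothD Uopen (smooth_lcomp Uopen lL cL fC)
  (smooth_lcomp Uopen lR cR gC))) => x _.
by congr pair; rewrite /= ?addr0 ?add0r.
Qed.

End SmoothnessOperations.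

Section SmoothnessApply.
Context {R : realType} {n : nat} {W : normedModType R}.
Variables (U : set ('rV[R]_n * 'rV[R]_n)) (Uopen : open U).

(** Contraction with the Liouville field in a natural chart. Smoothness is known for each fixed
    vector, so the fibre coordinate is expanded in the basis. *)
Lemma smooth_apply_snd (F : 'rV[R]_n * 'rV[R]_n -> 'rV[R]_n -> W) :
  (forall z, U z -> linear (F z)) -> (forall u, smooth_on U (F ^~ u)) ->
  smooth_on U (fun z => F z z.2).
Proof.
move=> Fl FC m.
apply: (@eq_Ck _ _ _ U Uopen m
  (fun z => \sum_(j < n) z.2 ord0 j *: F z (delta_mx 0 j))) => [z Uz|].
  exact: esym (linear_sum_coord z.2 (Fl z Uz)).
apply: (Ck_sum Uopen) => j; apply: (Ck_scale Uopen) (FC _ m).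
apply: (Ck_linear Uopen) => [a u v|z]; first by rewrite /= !mxE.
apply: (@continuous_comp _ _ _ snd (fun N : 'rV[R]_n => N ord0 j) z).
  exact: cvg_snd.
exact: coord_continuous.
Qed.

End SmoothnessApply.

(** * Sections read in natural charts and restricted to fibres *)

Section FibreFormulas.
Context {R : realType} {n : nat} {M : smoothManifold 'rV[R]_n}.
Local Notation E := 'rV[R]_n.
Local Notation TM := (M * E)%type.
Local Notation xM := (matlas M).
Local Notation xTM := (tangent_atlas (matlas M)).
Implicit Types (i : aidx xM) (x : M) (v : TM) (z : E * E) (A : set TM).
Local Notation tco := (tcoord (a := xM)).
Local Notation tve := (tvec (a := xM)).
Local Notation tr2 := (transition2 (a := xM)).

Lemma vfield_comp_cmap i (G : vfield M) v : cdom (xM i) v.1 ->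
  vfield_comp i G (cmap (xTM i) v) =
  (tco i v.1 (G v).1, tr2 i v.1 v.2 (G v).1 + tco i v.1 (G v).2).
Proof.
by move=> vi; rewrite /vfield_comp tangent_cinv_cmap// tcoord_tangent.
Qed.

Lemma nl_comp_cmap i (N : nlfield M) v u : cdom (xM i) v.1 ->
  nl_comp i N (cmap (xTM i) v) (tco i v.1 u) =
  (tco i v.1 (N v u).1, tr2 i v.1 v.2 (N v u).1 + tco i v.1 (N v u).2).
Proof.
by move=> vi; rewrite /nl_comp tangent_cinv_cmap// tcoord_tangent// tcoordK.
Qed.

Lemma christoffel_cmap i (Gam : anisfield M) v u1 u2 : cdom (xM i) v.1 ->
  christoffel i Gam (cmap (xTM i) v) (tco i v.1 u1) (tco i v.1 u2) =
  tco i v.1 (Gam v u1 u2) - tr2 i v.1 u1 u2.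
Proof. by move=> vi; rewrite /christoffel tangent_cinv_cmap// !tcoordK. Qed.

Lemma tens_comp_cmap s i (T : tensfield M s) v w : cdom (xM i) v.1 ->
  tens_comp i T (cmap (xTM i) v) (fun k => tco i v.1 (w k)) =
  tco i v.1 (T v w).
Proof.
move=> vi; rewrite /tens_comp tangent_cinv_cmap//; congr (tco _ _ (T v _)).
by apply/funext => k; rewrite tcoordK.
Qed.

Lemma vfield_comp_pref (G : vfield M) v :
  vfield_comp (apref xM v.1) G (cmap (xTM (apref xM v.1)) v) = G v.
Proof.
rewrite vfield_comp_cmap; last exact: mpref.
by rewrite transition2_pref add0r !tcoord_pref -surjective_pairing.
Qed.

Lemma nl_comp_pref (N : nlfield M) v u :
  nl_comp (apref xM v.1) N (cmap (xTM (apref xM v.1)) v) u = N v u.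
Proof.
rewrite -{1}(tcoord_pref v.1 u) nl_comp_cmap; last exact: mpref.
by rewrite transition2_pref add0r !tcoord_pref -surjective_pairing.
Qed.

Lemma christoffel_pref (Gam : anisfield M) v u1 u2 :
  christoffel (apref xM v.1) Gam (cmap (xTM (apref xM v.1)) v) u1 u2 =
  Gam v u1 u2.
Proof.
rewrite -{1}(tcoord_pref v.1 u1) -{1}(tcoord_pref v.1 u2).
rewrite christoffel_cmap; last exact: mpref.
by rewrite transition2_pref subr0 tcoord_pref.
Qed.

(** The formulas at [cmap (xTM i) v] take their vector arguments as images under [tcoord]; this
    makes them available for arbitrary components. *)
Lemma tcoord_surj i x (u : E) : cdom (xM i) x -> exists t, u = tco i x t.
Proof. by move=> xi; exists (tve i x u); rewrite tvecK. Qed.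

(* Every natural chart is affine along the fibres, hence derivatives in the
   direction (0, u) can be computed in the fibre itself. *)
Lemma derive_fibre (W : normedModType R) i v w (F : E * E -> W) :
  'D_(0, tco i v.1 w) F (cmap (xTM i) v) =
  'D_w (fun y => F (cmap (xTM i) (v.1, y))) v.2.
Proof.
have lineE h : cmap (xTM i) (v.1, h *: w + v.2) =
    h *: ((0, tco i v.1 w) : E * E) + cmap (xTM i) v.
  congr pair; first by rewrite /= scaler0 add0r.
  exact: tcoord_linear.
rewrite /derive; set d := (fun _ : R => _); set d' := (fun _ : R => _).
suff -> : d = d' by [].
apply/funext => h.
by rewrite -[d' h]/(h^-1 *: (F (cmap (xTM i) (v.1, h *: w + v.2))
                          - F (cmap (xTM i) v))) lineE.
Qed.

Lemma derive_fibre_pref (W : normedModType R) v w (F : E * E -> W) :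
  'D_(0, w) F (cmap (xTM (apref xM v.1)) v) =
  'D_w (fun y => F (cmap (xTM (apref xM v.1)) (v.1, y))) v.2.
Proof. by rewrite -derive_fibre tcoord_pref. Qed.

Lemma differentiable_fibre (W : normedModType R) A i v (F : E * E -> W) :
  smooth_on (coord_dom A i) F -> A v -> cdom (xM i) v.1 ->
  differentiable (fun y => F (cmap (xTM i) (v.1, y))) v.2.
Proof.
move=> FC Av vi.
have Av' : coord_dom A i (cmap (xM i) v.1, tco i v.1 v.2) by exists v.
have d1 := is_diff_pair (is_diff_cst (cmap (xM i) v.1) v.2)
  (linear_is_diff v.2 (@tcoord_linear _ _ _ i v.1)
    (@tcoord_continuous _ _ _ i v.1 vi)).
exact: differentiable_comp (@ex_diff _ _ _ _ _ _ _ d1) ((FC 1%N).1 _ Av').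
Qed.

Section Domain.
Variables (A : set TM) (hA : conic_domain A).

Lemma coord_dom_open i : open (coord_dom A i).
Proof. by have [Aopen _ _ _] := hA; exact: Aopen. Qed.

(** Linearity and homogeneity of sections hold on A only; this is what allows them to be
    differentiated along a fibre. *)
Lemma near_fibre v : A v -> \forall y \near v.2, A (v.1, y).
Proof.
move=> Av; have vp := mpref v.1.
have zv : coord_dom A (apref xM v.1) (cmap (xM (apref xM v.1)) v.1, v.2).
  by exists v => //; rewrite /= tcoord_pref.
have [dpair _] := is_diff_pair
  (is_diff_cst (cmap (xM (apref xM v.1)) v.1) v.2) (is_diff_id v.2).
have c := differentiable_continuous dpair.
have zn : \forall y \near v.2,
    coord_dom A (apref xM v.1) (cmap (xM (apref xM v.1)) v.1, y).
  by apply: c; apply: open_nbhs_nbhs; split; [exact: coord_dom_open|].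
apply: filterS zn => y [v' [Av' v'p] [E1 E2]].
(* Openness only yields some point of A with the given coordinates; injectivity of the chart
   identifies it with (v.1, y). *)
have v1 : v'.1 = v.1.
  by rewrite -(mcmapK v'p) E1 mcmapK.
by move: E2; rewrite v1 tcoord_pref => <-; rewrite -v1 -surjective_pairing.
Qed.

End Domain.
End FibreFormulas.

(** * The operators: formulas, well-definedness, identities and affine structure *)

Section Operators.
Context {R : realType} {n : nat} {M : smoothManifold 'rV[R]_n}.
Local Notation E := 'rV[R]_n.
Local Notation TM := (M * E)%type.
Local Notation xM := (matlas M).
Local Notation xTM := (tangent_atlas (matlas M)).
Local Notation tco := (tcoord (a := xM)).
Local Notation tr2 := (transition2 (a := xM)).
Implicit Types (i : aidx xM) (x : M) (v : TM) (z : E * E).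
Variables (A : set TM) (hA : conic_domain A).

Local Notation openA := (@coord_dom_open _ _ _ A hA _).
Local Notation fibG G x := (fun y : E => (G (x, y)).2).
Local Notation fibN N x u := (fun y : E => (N (x, y) u).2).
Local Notation fibC Gam x u1 u2 := (fun y : E => Gam (x, y) u1 u2).

(** One factor [l] comes from the spray law and one from the differential of [hmul l], hence degree
    two. The horizontal half of the law follows from the horizontal part being v. *)
Lemma sprayP (G : vfield M) : spray A G <->
  [/\ (forall v, ~ A v -> G v = 0),
      (forall i, smooth_on (coord_dom A i) (vfield_comp i G)),
      (forall v, A v -> (G v).1 = v.2) &
      (forall v l, A v -> 0 < l -> (G (hmul l v)).2 = l ^+ 2 *: (G v).2)].
Proof.
have [_ _ _ Aconic] := hA.
split=> -[Goff Gs G1 Gh]; split=> //.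
- by move=> v Av; rewrite -(G1 v Av) mdiff_fst.
- by move=> v l Av l0; rewrite (Gh v l Av l0) mdiff_hmul /= scalerA expr2.
- by move=> v Av; rewrite mdiff_fst G1.
- move=> v l Av l0; rewrite mdiff_hmul.
  rewrite [LHS]surjective_pairing Gh// G1; last exact: Aconic.
  by rewrite G1//; congr pair; rewrite /= scalerA expr2.
Qed.

Lemma nlconnP (N : nlfield M) : nlconn A N <->
  [/\ (forall v, ~ A v -> N v = fun=> 0),
      (forall v, A v -> linear (N v)),
      (forall i u, smooth_on (coord_dom A i) (fun z => nl_comp i N z u)),
      (forall v u, A v -> (N v u).1 = u) &
      (forall v l u, A v -> 0 < l -> (N (hmul l v) u).2 = l *: (N v u).2)].
Proof.
have [_ _ _ Aconic] := hA.
split=> -[Noff Nl Ns N1 Nh]; split=> //.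
- by move=> v u Av; rewrite -[RHS](N1 v u Av) mdiff_fst.
- by move=> v l u Av l0; rewrite (Nh v l u Av l0) mdiff_hmul.
- by move=> v u Av; rewrite mdiff_fst N1.
- move=> v l u Av l0; rewrite mdiff_hmul.
  by rewrite [LHS]surjective_pairing Nh// !N1//; exact: Aconic.
Qed.

Lemma cmap_hmul i v l : cmap (xTM i) (hmul l v) =
  ((cmap (xTM i) v).1, l *: (cmap (xTM i) v).2).
Proof. by congr pair; exact: linearZ. Qed.

(** Natural charts are linear on fibres, and v and [hmul l v] share their base point, so homogeneity
    of the components is homogeneity of T itself. *)
Lemma htensP s alpha (T : tensfield M s) : htens A alpha T <->
  [/\ (forall v, ~ A v -> T v = fun=> 0),
      (forall v, A v -> multilinear (T v)),
      (forall i w, smooth_on (coord_dom A i) (fun z => tens_comp i T z w)) &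
      (forall v l w, A v -> 0 < l -> T (hmul l v) w = l ^ alpha *: T v w)].
Proof.
split=> -[Toff Tm Ts Th]; split=> //.
- move=> v l w Av l0.
  have vp := mpref v.1; set p := apref xM v.1 in vp.
  have zA : coord_dom A p (cmap (xTM p) v) by exists v.
  have := Th p (cmap (xTM p) v) l (fun k => tco p v.1 (w k)) zA l0.
  by rewrite -cmap_hmul !tens_comp_cmap// /hmul /= !tcoord_pref.
- move=> i _ l w [v [Av vi] <-] l0; rewrite -cmap_hmul.
  have -> : w = (fun k => tco i v.1 (tvec (a := xM) i v.1 (w k))).
    by apply/funext => k; rewrite tvecK.
  rewrite (@tens_comp_cmap _ _ _ _ _ _ (hmul l v))// tens_comp_cmap// Th//.
  exact: linearZ.
Qed.

Lemma spray_fibre_diff G v : spray A G -> A v ->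
  differentiable (fibG G v.1) v.2.
Proof.
move=> /sprayP[_ Gs _ _] Av.
set p := apref xM v.1.
have := differentiable_fibre (smooth_snd openA (Gs p)) Av (mpref _).
congr (differentiable _ _); apply/funext => y.
by rewrite (vfield_comp_pref G (v.1, y)).
Qed.

Lemma nlconn_fibre_diff N v u : nlconn A N -> A v ->
  differentiable (fibN N v.1 u) v.2.
Proof.
move=> /nlconnP[_ _ Ns _ _] Av.
set p := apref xM v.1.
have := differentiable_fibre (smooth_snd openA (Ns p u)) Av (mpref _).
congr (differentiable _ _); apply/funext => y.
by rewrite (nl_comp_pref N (v.1, y)).
Qed.

Lemma anisconn_fibre_diff Gam v u1 u2 : anisconn A Gam -> A v ->
  differentiable (fibC Gam v.1 u1 u2) v.2.
Proof.
move=> [_ _ Cs _] Av; set p := apref xM v.1.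
have := differentiable_fibre (Cs p u1 u2) Av (mpref _).
congr (differentiable _ _); apply/funext => y.
by rewrite (christoffel_pref Gam (v.1, y)).
Qed.

(** The vertical part of G is -2 G^i and that of the connection is - G^i_{.j}: the signs cancel and
    the factor 1/2 remains. *)
Lemma ddot_sprE G v u : spray A G -> A v ->
  ddot_spr A G v u = (u, 2^-1 *: 'd (fibG G v.1) (v.2) u).
Proof.
move=> GA Av; rewrite /ddot_spr mem_set//; congr pair.
have dG := differentiableP (spray_fibre_diff GA Av).
rewrite derive_fibre_pref.
rewrite (near_eq_derive_diff u _ (is_diffN (is_diffZ 2^-1 dG))) ?opprK//.
apply: (@filterE _ (nbhs (v.2))) => y.
by rewrite /spray_coef (vfield_comp_pref G (v.1, y)).
Qed.

Lemma iota_sprE N v : A v -> iota_spr A N v = (v.2, (N v v.2).2).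
Proof.
move=> Av; rewrite /iota_spr mem_set//.
by rewrite /nl_coef opprK (nl_comp_pref N).
Qed.

Lemma ddot_nlE N v u1 u2 : nlconn A N -> A v ->
  ddot_nl A N v u1 u2 = - 'd (fibN N v.1 u1) (v.2) u2.
Proof.
move=> NA Av; rewrite /ddot_nl mem_set//.
have dN := differentiableP (nlconn_fibre_diff u1 NA Av).
rewrite derive_fibre_pref; apply: (near_eq_derive_diff u2 _ (is_diffN dN)).
apply: (@filterE _ (nbhs (v.2))) => y.
by rewrite /nl_coef (nl_comp_pref N (v.1, y)).
Qed.

Lemma iota_nlE Gam v u : A v -> iota_nl A Gam v u = (u, - Gam v u v.2).
Proof. by move=> Av; rewrite /iota_nl mem_set// (christoffel_pref Gam). Qed.

Lemma ddot_anisE Gam v w : anisconn A Gam -> A v ->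
  ddot_anis A Gam v w = 'd (fibC Gam v.1 (w 0) (w 1)) (v.2) (w 2).
Proof.
move=> GA Av; rewrite /ddot_anis mem_set//.
have dG := differentiableP (anisconn_fibre_diff (w 0) (w 1) GA Av).
rewrite derive_fibre_pref; apply: (near_eq_derive_diff (w 2) _ dG).
apply: (@filterE _ (nbhs (v.2))) => y.
exact: (christoffel_pref Gam (v.1, y)).
Qed.

(* Under a change of chart the vertical part g of a spray becomes
   D^2 tau(y, y) + Dtau g, whose fibre derivative along t is
   2 D^2 tau(y, t) + Dtau (D_t g) because D^2 tau is symmetric. *)
Lemma nl_comp_ddot_spr G i z u : spray A G -> coord_dom A i z ->
  nl_comp i (ddot_spr A G) z u =
  (u, 2^-1 *: 'D_(0, u) (fun z => (vfield_comp i G z).2) z).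
Proof.
move=> GA [v [Av vi] <-]; have [t ->] := tcoord_surj u vi.
have [_ _ G1 _] := (sprayP G).1 GA.
have dG := differentiableP (spray_fibre_diff GA Av).
rewrite nl_comp_cmap// ddot_sprE// derive_fibre.
have d1 := is_diff_bilinear_diag v.2 (@transition2_linearr _ _ _ i v.1)
  (fun w => @transition2_linearl _ _ _ i v.1 w vi)
  (fun w => @transition2_continuous _ _ _ i v.1 w vi).
have d2 := is_diff_lcomp (@tcoord_linear _ _ _ i v.1)
  (@tcoord_continuous _ _ _ i v.1 vi) dG.
rewrite (near_eq_derive_diff t _ (is_diffD d1 d2)).
  have half (w : E) : 2^-1 *: (w + w) = w.
    by rewrite -mulr2n -[w *+ 2]scaler_nat scalerA mulVf ?pnatr_eq0// scale1r.
  congr pair; rewrite !fctE /= (transition2_sym t v.2 vi) scalerDr half.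
  by rewrite [tco _ _ _]linearZ.
apply: filterS (near_fibre hA Av) => y Avy.
by rewrite vfield_comp_cmap// (G1 (v.1, y)).
Qed.

(** Both sides acquire the same term D^2 tau(y, y), because the connection is evaluated at u = y. *)
Lemma vfield_comp_iota_spr N i z : nlconn A N -> coord_dom A i z ->
  vfield_comp i (iota_spr A N) z = (z.2, (nl_comp i N z z.2).2).
Proof.
move=> /nlconnP[_ _ _ N1 _] [v [Av vi] <-].
by rewrite vfield_comp_cmap// iota_sprE// nl_comp_cmap// N1.
Qed.

(** The inhomogeneous term D^2 tau(y, t1) is linear in y; its fibre derivative along t2 is, up to
    sign, the one in the Christoffel rule. *)
Lemma christoffel_ddot_nl N i z u1 u2 : nlconn A N -> coord_dom A i z ->
  christoffel i (ddot_nl A N) z u1 u2 =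
  - 'D_(0, u2) (fun z => (nl_comp i N z u1).2) z.
Proof.
move=> NA [v [Av vi] <-].
have [t1 ->] := tcoord_surj u1 vi; have [t2 ->] := tcoord_surj u2 vi.
have [_ _ _ N1 _] := (nlconnP N).1 NA.
have dN := differentiableP (nlconn_fibre_diff t1 NA Av).
rewrite christoffel_cmap// ddot_nlE// derive_fibre.
have d1 := linear_is_diff v.2 (@transition2_linearr _ _ _ i v.1 t1)
  (@transition2_continuous _ _ _ i v.1 t1 vi).
have d2 := is_diff_lcomp (@tcoord_linear _ _ _ i v.1)
  (@tcoord_continuous _ _ _ i v.1 vi) dN.
rewrite (near_eq_derive_diff t2 _ (is_diffD d1 d2)).
  by rewrite !fctE /= [tco _ _ _]linearN opprD addrC.
apply: filterS (near_fibre hA Av) => y Avy.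
by rewrite nl_comp_cmap// (N1 (v.1, y))// (transition2_sym _ _ vi).
Qed.

Lemma nl_comp_iota_nl Gam i z u : coord_dom A i z ->
  nl_comp i (iota_nl A Gam) z u = (u, - christoffel i Gam z u z.2).
Proof.
move=> [v [Av vi] <-]; have [t ->] := tcoord_surj u vi.
rewrite nl_comp_cmap// iota_nlE// christoffel_cmap//; congr pair => /=.
by rewrite [tco _ _ _]linearN opprB (transition2_sym _ _ vi).
Qed.

(** The inhomogeneous term of Christoffel symbols is constant along fibres, so the vertical
    derivative kills it and leaves a tensor. *)
Lemma tens_comp_ddot_anis Gam i z w : anisconn A Gam -> coord_dom A i z ->
  tens_comp i (ddot_anis A Gam) z w =
  'D_(0, w 2) (fun z => christoffel i Gam z (w 0) (w 1)) z.
Proof.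
move=> GA [v [Av vi] <-].
have -> : w = (fun k => tco i v.1 (tvec (a := xM) i v.1 (w k))).
  by apply/funext => k; rewrite tvecK.
set t := fun k => tvec (a := xM) i v.1 (w k).
rewrite -/(t _); rewrite tens_comp_cmap// ddot_anisE// derive_fibre.
have dG := differentiableP (anisconn_fibre_diff (t 0) (t 1) GA Av).
have d2 := is_diff_lcomp (@tcoord_linear _ _ _ i v.1)
  (@tcoord_continuous _ _ _ i v.1 vi) dG.
have dc := is_diff_cst (tr2 i v.1 (t 0) (t 1)) v.2.
rewrite (near_eq_derive_diff (t 2) _ (is_diffB d2 dc)).
  by rewrite !fctE /= subr0.
by apply: (@filterE _ (nbhs (v.2))) => y; rewrite christoffel_cmap.
Qed.

Lemma tens_comp_iotaC s (S : tensfield M s.+1) i z w : coord_dom A i z ->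
  tens_comp i (iotaC S) z w =
  tens_comp i S z (fun k => oapp w z.2 (unlift ord_max k)).
Proof.
move=> [v [Av vi] <-]; rewrite /tens_comp tangent_cinv_cmap//.
congr (tco _ _ (S v _)); apply/funext => k.
by case: (unlift ord_max k) => //=; rewrite tcoordK.
Qed.

Lemma nl_comp_sub (N : nlfield M) J i z u : coord_dom A i z ->
  nl_comp i (nl_sub N J) z u =
  nl_comp i N z u - (0, tens_comp i J z (fun=> u)).
Proof.
move=> [v [Av vi] <-]; have [t ->] := tcoord_surj u vi.
rewrite !nl_comp_cmap// (tens_comp_cmap J (fun=> t))//.
by congr pair; rewrite /= ?subr0// [tco _ _ (_ - _)]linearB addrA.
Qed.

(** Both connections have horizontal part u, so their terms in D^2 tau cancel. *)
Lemma tens_comp_nl_diff (N N' : nlfield M) i z w :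
  nlconn A N -> nlconn A N' -> coord_dom A i z ->
  tens_comp i (nl_diff N N') z w =
  (nl_comp i N z (w 0)).2 - (nl_comp i N' z (w 0)).2.
Proof.
move=> /nlconnP[_ _ _ N1 _] /nlconnP[_ _ _ N'1 _] [v [Av vi] <-].
have -> : w = (fun k => tco i v.1 (tvec (a := xM) i v.1 (w k))).
  by apply/funext => k; rewrite tvecK.
rewrite tens_comp_cmap// !nl_comp_cmap//= N1// N'1//.
by rewrite opprD addrACA subrr add0r /nl_diff [LHS]linearB.
Qed.

Lemma christoffel_add (Gam : anisfield M) P i z u1 u2 : coord_dom A i z ->
  christoffel i (anis_add Gam P) z u1 u2 =
  christoffel i Gam z u1 u2 + tens_comp i P z (tnth [tuple u1; u2]).
Proof.
move=> [v [Av vi] <-].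
rewrite /christoffel /tens_comp /anis_add [tco _ _ (_ + _)]linearD addrAC.
congr (_ + tco _ _ (P _ _)); apply/funext => k; rewrite !(tnth_nth 0) /=.
by case: k => -[|[|]].
Qed.

Lemma tens_comp_anis_diff (Gam Gam' : anisfield M) i z w :
  tens_comp i (anis_diff Gam Gam') z w =
  christoffel i Gam z (w 0) (w 1) - christoffel i Gam' z (w 0) (w 1).
Proof.
rewrite /tens_comp /christoffel /anis_diff opprB addrA subrK.
exact: linearB.
Qed.

Lemma hmul_in v l : 0 < l -> A v -> A (hmul l v).
Proof. by have [_ _ _ Ac] := hA; exact: Ac. Qed.

Lemma nl_comp_linear N i z : nlconn A N -> coord_dom A i z ->
  linear (nl_comp i N z).
Proof.
move=> [_ Nl _ _ _] [v [Av vi] <-] a u w; rewrite /nl_comp tangent_cinv_cmap//.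
rewrite [tvec _ _ _]linearP Nl//; exact: linearP.
Qed.

Lemma christoffel_linear Gam i z u : anisconn A Gam -> coord_dom A i z ->
  linear (christoffel i Gam z u).
Proof.
move=> [_ Gl _ _] [v [Av vi] <-] a w w'; have [Gr _] := Gl v Av.
rewrite /christoffel tangent_cinv_cmap// [tvec _ _ (_ + _)]linearP Gr.
rewrite [tco _ _ _]linearP (transition2_linearr i _).
by rewrite opprD addrACA scalerBr.
Qed.

Lemma ddot_spr_nlconn G : spray A G -> nlconn A (ddot_spr A G).
Proof.
move=> GA; have [_ Gs _ Gh] := (sprayP G).1 GA; apply/nlconnP => //; split.
- by move=> v nAv; apply/funext => u; rewrite /ddot_spr memNset.
- move=> v Av a u w; rewrite !ddot_sprE//; congr pair.
  by rewrite linearP scalerDr /= !scalerA mulrC.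
- move=> i u; apply: (eq_smooth openA) => [z Az|].
    by rewrite nl_comp_ddot_spr.
  apply: (smooth_pair openA); first exact: (smooth_cst openA).
  by apply/(smoothZ openA)/(smooth_derive openA)/(smooth_snd openA).
- by move=> v u Av; rewrite ddot_sprE.
- move=> v l u Av l0; rewrite !ddot_sprE//; last exact: hmul_in.
  rewrite /= scalerA mulrC -scalerA; congr (_ *: _).
  have d1 := spray_fibre_diff GA Av.
  have d2 := spray_fibre_diff GA (hmul_in l0 Av).
  apply: (diff_homogeneous _ (lt0r_neq0 l0) d1 d2).
  apply: filterS (near_fibre hA Av) => y Avy.
  exact: (Gh (v.1, y)).
Qed.

Lemma iota_spr_spray N : nlconn A N -> spray A (iota_spr A N).
Proof.
move=> NA; have [_ _ Ns _ Nh] := (nlconnP N).1 NA.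
apply/sprayP => //; split.
- by move=> v nAv; rewrite /iota_spr memNset.
- move=> i; apply: (eq_smooth openA) => [z Az|].
    by rewrite vfield_comp_iota_spr.
  apply: (smooth_pair openA).
    by move=> m; apply: (Ck_linear openA) => // p; exact: cvg_snd.
  apply/(smooth_snd openA)/(smooth_apply_snd openA) => // z Az.
  exact: nl_comp_linear.
- by move=> v Av; rewrite iota_sprE.
- move=> v l Av l0; rewrite !iota_sprE//; last exact: hmul_in.
  rewrite /= Nh//; have [_ Nl _ _ _] := NA.
  by rewrite (linear_scale _ _ (Nl v Av)) /= scalerA expr2.
Qed.

Lemma ddot_nl_anisconn N : nlconn A N -> anisconn A (ddot_nl A N).
Proof.
move=> NA; have [_ Nl Ns _ Nh] := (nlconnP N).1 NA; split.
- move=> v nAv; apply/funext => u1; apply/funext => u2.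
  by rewrite /ddot_nl memNset.
- move=> v Av; split=> [u|u2] a w w'; rewrite !ddot_nlE//.
    by rewrite linearP opprD scalerN.
  have d1 := differentiableP (nlconn_fibre_diff w NA Av).
  have d2 := differentiableP (nlconn_fibre_diff w' NA Av).
  (* Linearity in the first slot is inherited from N at all nearby points of the fibre, not just at
     v. *)
  have near_eq : \forall y \near v.2,
      (a *: fibN N v.1 w + fibN N v.1 w') y = fibN N v.1 (a *: w + w') y.
    by apply: filterS (near_fibre hA Av) => y Avy; rewrite Nl.
  rewrite scalerN -opprD; congr (- _).
  exact: is_diffE u2 (near_eq_is_diff near_eq (is_diffD (is_diffZ a d1) d2)).
- move=> i u1 u2; apply: (eq_smooth openA) => [z Az|].
    by rewrite christoffel_ddot_nl.
  by apply/(smoothN openA)/(smooth_derive openA)/(smooth_snd openA).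
- move=> v l Av l0; apply/funext => u1; apply/funext => u2.
  have Avl := hmul_in l0 Av.
  rewrite (ddot_nlE u1 u2 NA Av) (ddot_nlE u1 u2 NA Avl).
  have d1 := nlconn_fibre_diff u1 NA Av.
  have d2 := nlconn_fibre_diff u1 NA Avl.
  have near_eq : \forall y \near v.2,
      fibN N v.1 u1 (l *: y) = (l * 1) *: fibN N v.1 u1 y.
    apply: filterS (near_fibre hA Av) => y Avy.
    by rewrite mulr1; exact: (Nh (v.1, y)).
  have := diff_homogeneous u2 (lt0r_neq0 l0) d1 d2 near_eq.
  by rewrite scale1r => dE; exact: (congr1 -%R dE).
Qed.

Lemma iota_nl_nlconn Gam : anisconn A Gam -> nlconn A (iota_nl A Gam).
Proof.
move=> GA; have [_ Gl Gs Gh] := GA; apply/nlconnP => //; split.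
- by move=> v nAv; apply/funext => u; rewrite /iota_nl memNset.
- move=> v Av a u w; rewrite !iota_nlE//; congr pair => /=.
  by rewrite (Gl v Av).2 opprD scalerN.
- move=> i u; apply: (eq_smooth openA) => [z Az|].
    by rewrite nl_comp_iota_nl.
  apply: (smooth_pair openA); first exact: (smooth_cst openA).
  apply: (smoothN openA).
  pose F z := christoffel i Gam z u.
  apply: (smooth_apply_snd openA (F := F)) => [z Az|w]; last exact: Gs.
  exact: christoffel_linear.
- by move=> v u Av; rewrite iota_nlE.
- move=> v l u Av l0; rewrite !iota_nlE//; last exact: hmul_in.
  rewrite /= Gh// scalerN; congr (- _).
  exact: (linear_scale _ _ ((Gl v Av).1 u)).
Qed.

Lemma ddot_anis_htens Gam : anisconn A Gam ->
  htens A (s := 3) (-1) (ddot_anis A Gam).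
Proof.
move=> GA; have [_ Gl Gs Gh] := GA; apply/htensP; split.
- by move=> v nAv; apply/funext => w; rewrite /ddot_anis memNset.
- move=> v Av k w a u u'; rewrite !(ddot_anisE _ GA Av).
  (* The first two slots belong to [Gam], whose linearity is differentiated along the fibre; the
     third is the direction of differentiation. *)
  have : k \in [:: (0 : 'I_3); 1; 2] by case: k => -[|[|[|]]].
  rewrite !inE => /or3P[] /eqP ->.
  + rewrite !dfwithin !(@dfwithout _ _ w 0 _ 1)// !(@dfwithout _ _ w 0 _ 2)//.
    have d1 := differentiableP (anisconn_fibre_diff u (w 1) GA Av).
    have d2 := differentiableP (anisconn_fibre_diff u' (w 1) GA Av).
    have near_eq : \forall y \near v.2,
        (a *: fibC Gam v.1 u (w 1) + fibC Gam v.1 u' (w 1)) y =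
        fibC Gam v.1 (a *: u + u') (w 1) y.
      by apply: filterS (near_fibre hA Av) => y Avy; rewrite (Gl _ Avy).2.
    exact: is_diffE (w 2) (near_eq_is_diff near_eq
      (is_diffD (is_diffZ a d1) d2)).
  + rewrite !dfwithin !(@dfwithout _ _ w 1 _ 0)// !(@dfwithout _ _ w 1 _ 2)//.
    have d1 := differentiableP (anisconn_fibre_diff (w 0) u GA Av).
    have d2 := differentiableP (anisconn_fibre_diff (w 0) u' GA Av).
    have near_eq : \forall y \near v.2,
        (a *: fibC Gam v.1 (w 0) u + fibC Gam v.1 (w 0) u') y =
        fibC Gam v.1 (w 0) (a *: u + u') y.
      by apply: filterS (near_fibre hA Av) => y Avy; rewrite (Gl _ Avy).1.
    exact: is_diffE (w 2) (near_eq_is_diff near_eq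
      (is_diffD (is_diffZ a d1) d2)).
  + rewrite !dfwithin !(@dfwithout _ _ w 2 _ 0)// !(@dfwithout _ _ w 2 _ 1)//.
    exact: linearP.
- move=> i w; apply: (eq_smooth openA) => [z Az|].
    by rewrite tens_comp_ddot_anis.
  exact: (smooth_derive openA).
- move=> v l w Av l0; have Avl := hmul_in l0 Av.
  rewrite (ddot_anisE _ GA Av) (ddot_anisE _ GA Avl).
  have d1 := anisconn_fibre_diff (w 0) (w 1) GA Av.
  have d2 := anisconn_fibre_diff (w 0) (w 1) GA Avl.
  (* Degree 0 is written with the factor [l * l ^ (-1)] so that the derivative comes out in degree
     -1. *)
  have near_eq : \forall y \near v.2,
      fibC Gam v.1 (w 0) (w 1) (l *: y) =
      (l * l ^ (-1)) *: fibC Gam v.1 (w 0) (w 1) y.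
    apply: filterS (near_fibre hA Av) => y Avy.
    by rewrite exprN1 mulfV ?lt0r_neq0// scale1r -(Gh (v.1, y) l).
  exact: (diff_homogeneous (w 2) (lt0r_neq0 l0) d1 d2 near_eq).
Qed.

(** The inserted vector scales with v, which raises the degree by one. *)
Lemma iotaC_htens s alpha (S : tensfield M s.+1) :
  htens A alpha S -> htens A (alpha + 1) (iotaC S).
Proof.
move=> /htensP[Soff Sm Ss Sh]; apply/htensP; split.
- by move=> v nAv; apply/funext => w; rewrite /iotaC Soff.
- move=> v Av k w a u u'; rewrite /iotaC.
  (* Changing entry k of [w] amounts to changing entry [lift ord_max k] of the full argument, the
     Liouville entry staying fixed. *)
  pose W := fun j => oapp w v.2 (unlift (ord_max : 'I_s.+1) j).
  have WE y : (fun j => oapp (dfwith w k y) v.2 (unlift ord_max j)) =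
      dfwith W (lift ord_max k) y.
    apply/funext => j; case: (unliftP ord_max j) => [j' ->|->].
      have [->|kj] := eqVneq k j'; first by rewrite /= !dfwithin.
      by rewrite /= !dfwithout ?(inj_eq lift_inj)// /W liftK.
    rewrite /= dfwithout; first by rewrite /W unlift_none.
    by rewrite eq_sym neq_lift.
  by rewrite !WE; exact: Sm.
- move=> i w; apply: (eq_smooth openA) => [z Az|].
    by rewrite (tens_comp_iotaC _ _ Az).
  (* The contracted vector is freed from z, the form required by [smooth_apply_snd]. *)
  pose F z u := tens_comp i S z (fun k => oapp w u (unlift ord_max k)).
  apply: (smooth_apply_snd openA (F := F)) => [_ [v [Av vi] <-] a u u'|u];
    last exact: Ss.
  rewrite /F /tens_comp tangent_cinv_cmap//.
  (* The default 0 in the last entry is a placeholder that [dfwith] overwrites. *)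
  pose W := fun j =>
    tvec (a := xM) i v.1 (oapp w 0 (unlift (ord_max : 'I_s.+1) j)).
  have WE y : (fun j => tvec (a := xM) i v.1 (oapp w y (unlift ord_max j))) =
      dfwith W ord_max (tvec (a := xM) i v.1 y).
    apply/funext => j; case: (unliftP ord_max j) => [j' ->|->].
      by rewrite dfwithout ?neq_lift// /W liftK.
    by rewrite dfwithin.
  rewrite !WE [tvec _ _ (_ + _)]linearP Sm//; exact: linearP.
- move=> v l w Av l0; rewrite /iotaC Sh// expfzDr ?lt0r_neq0// expr1z -scalerA.
  congr (_ *: _).
  pose W := fun j => oapp w 0 (unlift (ord_max : 'I_s.+1) j).
  have WE y : (fun j => oapp w y (unlift ord_max j)) = dfwith W ord_max y.
    apply/funext => j; case: (unliftP ord_max j) => [j' ->|->].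
      by rewrite dfwithout ?neq_lift// /W liftK.
    by rewrite dfwithin.
  rewrite !WE; exact: (linear_scale _ _ (Sm v Av ord_max _)).
Qed.

Lemma iota_ddot_spr G : spray A G -> iota_spr A (ddot_spr A G) = G.
Proof.
move=> GA; have [Goff _ G1 Gh] := (sprayP G).1 GA.
apply/funext => v; have [Av|nAv] := pselect (A v); last first.
  by rewrite /iota_spr memNset// Goff.
rewrite iota_sprE// (ddot_sprE _ GA Av) [RHS]surjective_pairing G1//=.
(* Degree two cancels the factor 1/2 of [ddot_sprE]. *)
rewrite (@euler_homogeneous _ _ _ _ v.2 2 (spray_fibre_diff GA Av)).
  by rewrite scalerA mulVf ?pnatr_eq0// scale1r -surjective_pairing.
by move=> l l0; rewrite -surjective_pairing -Gh.
Qed.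

Lemma iota_ddot_nl N : nlconn A N -> iota_nl A (ddot_nl A N) = N.
Proof.
move=> NA; have [Noff _ _ N1 Nh] := (nlconnP N).1 NA.
apply/funext => v; have [Av|nAv] := pselect (A v); last first.
  by apply/funext => u; rewrite /iota_nl memNset// Noff.
apply/funext => u.
rewrite iota_nlE// (ddot_nlE _ _ NA Av) opprK [RHS]surjective_pairing N1//.
rewrite (@euler_homogeneous _ _ _ _ v.2 1 (nlconn_fibre_diff u NA Av)).
  by rewrite scale1r -surjective_pairing.
by move=> l l0; rewrite -surjective_pairing expr1 -Nh.
Qed.

Lemma iotaC_ddot_anis Gam : anisconn A Gam ->
  iotaC (ddot_anis A Gam) = fun _ _ => 0.
Proof.
move=> GA; have [_ _ _ Gh] := GA.
apply/funext => v; apply/funext => w; rewrite /iotaC.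
have [Av|nAv] := pselect (A v); last by rewrite /ddot_anis memNset.
rewrite (ddot_anisE _ GA Av).
(* The direction of differentiation is the last slot, exactly the one that [iotaC] fills with v. *)
have -> : (2 : 'I_3) = ord_max by exact/val_inj.
rewrite unlift_none /=.
set w0 := oapp _ _ _; set w1 := oapp _ _ _.
rewrite (@euler_homogeneous _ _ _ _ v.2 0 (anisconn_fibre_diff w0 w1 GA Av)).
  by rewrite scale0r.
by move=> l l0; rewrite -surjective_pairing expr0 scale1r -(Gh v l).
Qed.

Lemma fun_ord1 (w : 'I_1 -> E) : w = fun=> w 0.
Proof. by apply/funext => k; rewrite ord1. Qed.

Lemma fun_ord2 (w : 'I_2 -> E) : w = tnth [tuple w 0; w 1].
Proof.
apply/funext => -[[|[|//]] k]; rewrite (tnth_nth 0) /=;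
  by congr w; exact/val_inj.
Qed.

Lemma tens1_linear (J : tensfield M 1) v : multilinear (J v) ->
  linear (fun u : E => J v (fun=> u)).
Proof.
move=> Jm a u u'; have := Jm 0 (fun=> 0) a u u'.
have dE y : dfwith (fun=> 0) (0 : 'I_1) y = fun=> y :> E.
  by apply/funext => k; rewrite ord1 dfwithin.
by rewrite !dE.
Qed.

Lemma tens2_linearl (P : tensfield M 2) v u2 : multilinear (P v) ->
  linear (fun u : E => P v (tnth [tuple u; u2])).
Proof.
move=> Pm a u u'; have := Pm 0 (fun=> u2) a u u'.
have dE y : dfwith (fun=> u2) (0 : 'I_2) y = tnth [tuple y; u2].
  by rewrite [LHS]fun_ord2 dfwithin dfwithout.
by rewrite !dE.
Qed.

Lemma tens2_linearr (P : tensfield M 2) v u1 : multilinear (P v) ->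
  linear (fun u : E => P v (tnth [tuple u1; u])).
Proof.
move=> Pm a u u'; have := Pm 1 (fun=> u1) a u u'.
have dE y : dfwith (fun=> u1) (1 : 'I_2) y = tnth [tuple u1; y].
  by rewrite [LHS]fun_ord2 dfwithin dfwithout.
by rewrite !dE.
Qed.

Lemma htens_opp s alpha (T : tensfield M s) :
  htens A alpha T -> htens A alpha (fun v w => - T v w).
Proof.
move=> /htensP[Toff Tm Ts Th]; apply/htensP; split.
- by move=> v nAv; apply/funext => w; rewrite Toff// oppr0.
- by move=> v Av k w a u u'; rewrite Tm// opprD scalerN.
- move=> i w; apply: (eq_smooth openA) (smoothN openA (Ts i w)) => z Az.
  exact/esym/linearN.
- by move=> v l w Av l0; rewrite Th// scalerN.
Qed.

Lemma nl_sub_nlconn N J : nlconn A N -> htens A (s := 1) 1 J ->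
  nlconn A (nl_sub N J).
Proof.
move=> /(nlconnP)[Noff Nl Ns N1 Nh] /htensP[Joff Jm Js Jh].
apply/nlconnP => //; split.
- by move=> v nAv; apply/funext => u; rewrite /nl_sub Noff// Joff// subr0.
- move=> v Av a u w; rewrite /nl_sub Nl// (tens1_linear (Jm v Av)).
  rewrite scalerBr [RHS]addrACA -opprD; congr (_ - _).
  by congr pair; rewrite /= ?scaler0 ?addr0.
- move=> i u; apply: (eq_smooth openA) => [z Az|].
    by rewrite (nl_comp_sub _ _ _ Az).
  apply: (smoothB openA); first exact: Ns.
  by apply: (smooth_pair openA); [exact: (smooth_cst openA)|exact: Js].
- by move=> v u Av; rewrite /nl_sub /= N1// subr0.
- by move=> v l u Av l0; rewrite /nl_sub /= Nh// Jh// expr1z scalerBr.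
Qed.

Lemma nl_diff_htens N N' : nlconn A N -> nlconn A N' ->
  htens A (s := 1) 1 (nl_diff N N').
Proof.
move=> NA N'A; have [Noff Nl Ns N1 Nh] := (nlconnP N).1 NA.
have [N'off N'l N's N'1 N'h] := (nlconnP N').1 N'A.
apply/htensP; split.
- by move=> v nAv; apply/funext => w; rewrite /nl_diff Noff// N'off// subr0.
- move=> v Av k w a u u'; rewrite /nl_diff (ord1 k) !dfwithin Nl// N'l//=.
  by rewrite opprD addrACA scalerBr.
- move=> i w; apply: (eq_smooth openA) => [z Az|].
    by rewrite (tens_comp_nl_diff w NA N'A Az).
  by apply: (smoothB openA); apply: (smooth_snd openA).
- by move=> v l w Av l0; rewrite /nl_diff /= Nh// N'h// expr1z scalerBr.
Qed.

Lemma anis_add_anisconn Gam P : anisconn A Gam -> htens A (s := 2) 0 P ->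
  anisconn A (anis_add Gam P).
Proof.
move=> [Goff Gl Gs Gh] /htensP[Poff Pm Ps Ph]; split.
- move=> v nAv; apply/funext => u1; apply/funext => u2.
  by rewrite /anis_add Goff// Poff// addr0.
- move=> v Av; have [Gr Gl'] := Gl v Av; split=> [u1|u2] a u u';
  rewrite /anis_add.
    by rewrite Gr (tens2_linearr u1 (Pm v Av)) scalerDr addrACA.
  by rewrite Gl' (tens2_linearl u2 (Pm v Av)) scalerDr addrACA.
- move=> i u1 u2; apply: (eq_smooth openA) => [z Az|].
    by rewrite (christoffel_add _ _ _ _ Az).
  by apply: (smoothD openA); [exact: Gs|exact: Ps].
- move=> v l Av l0; apply/funext => u1; apply/funext => u2.
  by rewrite /anis_add Gh// Ph// expr0z scale1r.
Qed.

Lemma anis_diff_htens Gam Gam' : anisconn A Gam -> anisconn A Gam' ->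
  htens A (s := 2) 0 (anis_diff Gam Gam').
Proof.
move=> [Goff Gl Gs Gh] [G'off G'l G's G'h]; apply/htensP; split.
- by move=> v nAv; apply/funext => w; rewrite /anis_diff Goff// G'off// subr0.
- move=> v Av k w a u u'; have [Gr Gl'] := Gl v Av; have [G'r G'l'] := G'l v Av.
  have : k \in [:: (0 : 'I_2); 1] by case: k => -[|[|]].
  rewrite !inE /anis_diff => /orP[] /eqP ->.
    rewrite !dfwithin !(@dfwithout _ _ w 0 _ 1)// Gl' G'l'.
    by rewrite opprD addrACA scalerBr.
  rewrite !dfwithin !(@dfwithout _ _ w 1 _ 0)// Gr G'r.
  by rewrite opprD addrACA scalerBr.
- move=> i w; apply: (eq_smooth openA) => [z Az|].
    by rewrite tens_comp_anis_diff.
  by apply: (smoothB openA); [exact: Gs|exact: G's].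
- by move=> v l w Av l0; rewrite /anis_diff Gh// G'h// expr0z scale1r.
Qed.

Lemma iotaC1E (J : tensfield M 1) v w : iotaC J v w = J v (fun=> v.2).
Proof.
by rewrite /iotaC [X in J v X]fun_ord1; case: unliftP => [[]|].
Qed.

Lemma iotaC2E (P : tensfield M 2) v w :
  iotaC P v w = P v (tnth [tuple w 0; v.2]).
Proof.
rewrite /iotaC [X in P v X]fun_ord2; congr (P v (tnth [tuple _; _])).
  by rewrite (_ : 0 = lift ord_max 0) ?liftK //; exact/val_inj.
by rewrite (_ : 1 = ord_max) ?unlift_none //; exact/val_inj.
Qed.

(** Together with [iota_ddot_spr] this recovers the spray from any decomposition, whence its
    uniqueness. *)
Lemma iota_spr_sub N J : iotaC J = (fun _ _ => 0) ->
  iota_spr A (nl_sub N J) = iota_spr A N.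
Proof.
move=> J0; apply/funext => v; have [Av|nAv] := pselect (A v).
  rewrite !iota_sprE// /nl_sub /=; congr pair.
  by rewrite -(iotaC1E J v (fun=> 0)) J0 subr0.
by rewrite /iota_spr memNset.
Qed.

Lemma iota_nl_add Gam P : iotaC P = (fun _ _ => 0) ->
  iota_nl A (anis_add Gam P) = iota_nl A Gam.
Proof.
move=> P0; apply/funext => v; apply/funext => u.
have [Av|nAv] := pselect (A v); last by rewrite /iota_nl memNset.
rewrite !iota_nlE// /anis_add; congr (_, - _).
by rewrite -(iotaC2E P v (fun=> u)) P0 addr0.
Qed.

Lemma nl_diff_ker N N' : nlconn A N -> nlconn A N' ->
  iota_spr A N = iota_spr A N' -> ker_iotaC A (s := 0) 1 (nl_diff N N').
Proof.
move=> NA N'A NN'; split; first exact: nl_diff_htens.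
apply/funext => v; apply/funext => w; rewrite iotaC1E /nl_diff /=.
have [Av|nAv] := pselect (A v); last first.
  by have [-> //] := NA; have [-> //] := N'A; rewrite subr0.
have := congr1 (fun G : vfield M => (G v).2) NN'.
by rewrite !iota_sprE//= => ->; rewrite subrr.
Qed.

Lemma anis_diff_ker Gam Gam' : anisconn A Gam -> anisconn A Gam' ->
  iota_nl A Gam = iota_nl A Gam' ->
  ker_iotaC A (s := 1) 0 (anis_diff Gam Gam').
Proof.
move=> GA G'A GG'; split; first exact: anis_diff_htens.
apply/funext => v; apply/funext => w; rewrite iotaC2E /anis_diff /=.
have [Av|nAv] := pselect (A v); last first.
  by have [-> //] := GA; have [-> //] := G'A; rewrite subr0.
have := congr1 (fun N : nlfield M => (N v (w 0)).2) GG'.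
rewrite !iota_nlE//= => /oppr_inj GE.
by rewrite !(tnth_nth 0) /= GE subrr.
Qed.

Lemma nl_add_diff N N' : nlconn A N -> nlconn A N' ->
  N = nl_add N' (nl_diff N N').
Proof.
move=> /(nlconnP)[Noff _ _ N1 _] /(nlconnP)[N'off _ _ N'1 _].
apply/funext => v; apply/funext => u; rewrite /nl_add /nl_sub /nl_diff /=.
have [Av|nAv] := pselect (A v); last first.
  by rewrite Noff// N'off//; congr pair; rewrite /= ?subr0 ?oppr0 ?addr0.
rewrite [LHS]surjective_pairing N1//; congr pair.
  by rewrite /= N'1// subr0.
by rewrite /= opprK addrC subrK.
Qed.

Lemma anis_add_diff (Gam Gam' : anisfield M) :
  Gam = anis_add Gam' (anis_diff Gam Gam').
Proof.
apply/funext => v; apply/funext => u1; apply/funext => u2.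
by rewrite /anis_add /anis_diff !(tnth_nth 0) /= addrC subrK.
Qed.

(** Translations act freely: the tensor of a decomposition is determined once its spray is. *)
Lemma nl_sub_inj (N : nlfield M) : injective (nl_sub N).
Proof.
move=> J J' JJ'; apply/funext => v; apply/funext => w; rewrite (fun_ord1 w).
have := congr1 (fun N' : nlfield M => (N' v (w 0)).2) JJ'.
by rewrite /nl_sub /= => /addrI /oppr_inj.
Qed.

Lemma anis_add_inj (Gam : anisfield M) : injective (anis_add Gam).
Proof.
move=> P P' PP'; apply/funext => v; apply/funext => w; rewrite (fun_ord2 w).
have := congr1 (fun G : anisfield M => G v (w 0) (w 1)) PP'.
by rewrite /anis_add => /addrI.
Qed.

Lemma ker_iotaC_opp s alpha (S : tensfield M s.+1) :
  ker_iotaC A alpha S -> ker_iotaC A alpha (fun v w => - S v w).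
Proof.
move=> [Sh S0]; split; first exact: htens_opp.
apply/funext => v; apply/funext => w.
by have /= := congr1 (fun T : tensfield M s => - T v w) S0; rewrite oppr0.
Qed.

End Operators.

(** * Assembly of the identities and the two decompositions *)

Theorem corollary5 (R : realType) (n : nat) (M : smoothManifold 'rV[R]_n)
    (A : set (M * 'rV[R]_n)) (hA : conic_domain A) :
  (* the maps between the stated spaces *)
  [/\ set_fun (spray A) (nlconn A) (ddot_spr A),
      set_fun (nlconn A) (spray A) (iota_spr A),
      set_fun (nlconn A) (anisconn A) (ddot_nl A),
      set_fun (anisconn A) (nlconn A) (iota_nl A) &
      set_fun (anisconn A) (htens A (s := 3) (-1)) (ddot_anis A)] /\
  [/\ set_fun (htens A (s := 3) (-1)) (htens A (s := 2) 0) (iotaC (s := 2)),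
      set_fun (htens A (s := 1) 1) (htens A (s := 0) 2) (iotaC (s := 0)) &
      set_fun (htens A (s := 2) 0) (htens A (s := 1) 1) (iotaC (s := 1))] /\
  (* the three identities *)
  [/\ (forall G, spray A G -> iota_spr A (ddot_spr A G) = G),
      (forall N, nlconn A N -> iota_nl A (ddot_nl A N) = N) &
      (forall Gam, anisconn A Gam -> iotaC (ddot_anis A Gam) = fun _ _ => 0)] /\
  (* injectivity and surjectivity *)
  [/\ set_inj (spray A) (ddot_spr A),
      set_inj (nlconn A) (ddot_nl A),
      set_surj (nlconn A) (spray A) (iota_spr A) &
      set_surj (anisconn A) (nlconn A) (iota_nl A)] /\
  (* (i) *)
  [/\ (forall G J, spray A G -> ker_iotaC A (s := 0) 1 J ->
         nlconn A (nl_sub (ddot_spr A G) J)),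
      (forall N, nlconn A N ->
         exists! GJ : vfield M * tensfield M 1,
           [/\ spray A GJ.1, ker_iotaC A (s := 0) 1 GJ.2 &
               N = nl_sub (ddot_spr A GJ.1) GJ.2]) &
      (forall N, nlconn A N ->
         let J := nl_diff N (ddot_spr A (iota_spr A N)) in
         ker_iotaC A (s := 0) 1 J /\ N = nl_add (ddot_spr A (iota_spr A N)) J)] /\
  (* (ii) *)
  [/\ (forall N P, nlconn A N -> ker_iotaC A (s := 1) 0 P ->
         anisconn A (anis_add (ddot_nl A N) P)),
      (forall Gam, anisconn A Gam ->
         exists! NP : nlfield M * tensfield M 2,
           [/\ nlconn A NP.1, ker_iotaC A (s := 1) 0 NP.2 &
               Gam = anis_add (ddot_nl A NP.1) NP.2]) &
      (forall Gam, anisconn A Gam ->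
         let P := anis_diff Gam (ddot_nl A (iota_nl A Gam)) in
         ker_iotaC A (s := 1) 0 P /\ Gam = anis_add (ddot_nl A (iota_nl A Gam)) P)].
Proof.
have spr_ker N (NA : nlconn A N) : ker_iotaC A (s := 0) 1
    (nl_diff N (ddot_spr A (iota_spr A N))).
  have GA := iota_spr_spray hA NA.
  (* The first identity at [iota_spr A N] shows that N and its projection have the same image under
     [iota_spr]. *)
  exact: (nl_diff_ker hA NA (ddot_spr_nlconn hA GA)
    (esym (iota_ddot_spr hA GA))).
have nl_ker Gam (GA : anisconn A Gam) : ker_iotaC A (s := 1) 0
    (anis_diff Gam (ddot_nl A (iota_nl A Gam))).
  have NA := iota_nl_nlconn hA GA.
  exact: (anis_diff_ker hA GA (ddot_nl_anisconn hA NA)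
    (esym (iota_ddot_nl hA NA))).
split; first by split; [exact: ddot_spr_nlconn|exact: iota_spr_spray|
  exact: ddot_nl_anisconn|exact: iota_nl_nlconn|exact: ddot_anis_htens].
split; first by split; move=> S /(iotaC_htens hA).
split; first by split; [exact: iota_ddot_spr|exact: iota_ddot_nl|
  exact: iotaC_ddot_anis].
split.
  split.
  - move=> G G'; rewrite !inE => GA G'A GG'.
    by rewrite -(iota_ddot_spr hA GA) GG' iota_ddot_spr.
  - move=> N N'; rewrite !inE => NA N'A NN'.
    by rewrite -(iota_ddot_nl hA NA) NN' iota_ddot_nl.
  - move=> G GA; exists (ddot_spr A G); first exact: ddot_spr_nlconn.
    exact: iota_ddot_spr.
  - move=> N NA; exists (ddot_nl A N); first exact: ddot_nl_anisconn.
    exact: iota_ddot_nl.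
split.
  split.
  - move=> G J GA [JA _].
    exact: (nl_sub_nlconn hA (ddot_spr_nlconn hA GA) JA).
  - move=> N NA; have GA := iota_spr_spray hA NA.
    have NE := nl_add_diff hA NA (ddot_spr_nlconn hA GA).
    (* The decomposition subtracts its tensor, so the witness is minus the difference. *)
    exists (iota_spr A N,
      fun v w => - nl_diff N (ddot_spr A (iota_spr A N)) v w); split=> /=.
      by split=> //; exact/ker_iotaC_opp/spr_ker.
    move=> [G J] /= [G_A [_ J0] NGJ].
    (* Applying [iota_spr] to the decomposition removes J and forces G; freeness of translations
       then forces J. *)
    have GE : iota_spr A N = G by rewrite NGJ iota_spr_sub// iota_ddot_spr.
    congr pair => //; apply: (@nl_sub_inj _ _ _ (ddot_spr A G)).
    by rewrite -NGJ -GE; exact: esym NE.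
  - move=> N NA; split; first exact: spr_ker.
    exact/(nl_add_diff hA)/ddot_spr_nlconn/iota_spr_spray.
split.
- move=> N P NA [PA _].
  exact: (anis_add_anisconn hA (ddot_nl_anisconn hA NA) PA).
- move=> Gam GA.
  exists (iota_nl A Gam, anis_diff Gam (ddot_nl A (iota_nl A Gam))); split=> /=.
    by split; [exact: iota_nl_nlconn|exact: nl_ker|exact: anis_add_diff].
  move=> [N P] /= [NA [_ P0] GNP].
  have NE : iota_nl A Gam = N by rewrite GNP iota_nl_add// iota_ddot_nl.
  congr pair => //; apply: (@anis_add_inj _ _ _ (ddot_nl A N)).
  by rewrite -GNP -NE -anis_add_diff.
- by move=> Gam GA; split; [exact: nl_ker|exact: anis_add_diff].
Qed.
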